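(* Let $m,n\in\mathbb{N}_0$ with $0\le m\le n$, $\sigma,\sigma'\in(0,\infty)$, and $\theta'\in(0,\pi)$. Then \[ \int_0^\pi Q_{m-1/2}(\chi)\,\mathrm{P}^m_n(\cos\theta)\sqrt{\sin\theta}\,d\theta=\frac{2\pi\sqrt{\sin\theta'}}{2n+1}\,\mathrm{P}^m_n(\cos\theta')\,e^{-(n+1/2)(\sigma_>-\sigma_<)}, \] where, with $s=\cosh\sigma$, $s'=\cosh\sigma'$, $\tau=\cos\theta$, $\tau'=\cos\theta'$, \[ \chi=\frac{\sin^2\theta\,(s'-\tau')^2+\sin^2\theta'\,(s-\tau)^2+\left[(s'-\tau')\sinh\sigma-(s-\tau)\sinh\sigma'\right]^2}{2\sin\theta\sin\theta'(s-\tau)(s'-\tau')}, \] and $\sigma_<=\min\{\sigma,\sigma'\}$, $\sigma_>=\max\{\sigma,\sigma'\}$.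
   Context: $Q_\nu=Q^0_\nu$, where for $z\in\mathbb{C}\setminus(-\infty,1]$, $Q^\mu_\nu(z)=e^{\mu\pi i}\frac{\sqrt{\pi}\,\Gamma(\nu+\mu+1)(z^2-1)^{\mu/2}}{2^{\nu+1}z^{\nu+\mu+1}}\,\mathbf{F}\!\left(\frac{\nu+\mu}{2}+1,\frac{\nu+\mu+1}{2};\nu+\frac32;\frac{1}{z^2}\right)$ with $\mathbf{F}={}_2F_1/\Gamma(c)$ (principal branches). $\mathrm{P}^m_n$ is the Ferrers function of the first kind: for integers $0\le m\le n$ and $x\in(-1,1)$, $\mathrm{P}^m_n(x)=(-1)^m(1-x^2)^{m/2}\frac{d^m}{dx^m}P_n(x)$ with $P_n$ the Legendre polynomial. Note $\chi\ge1$, with $\chi=1$ only when $\sigma=\sigma'$ and $\theta=\theta'$ (logarithmic singularity of $Q_{m-1/2}$). *)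

(* Defs.v *)
From HB Require Import structures.
From mathcomp Require Import all_boot all_order all_algebra.
From mathcomp Require Import all_classical all_reals all_analysis.
Set Implicit Arguments. Unset Strict Implicit. Unset Printing Implicit Defensive.
Import Order.TTheory GRing.Theory Num.Theory.
Import numFieldNormedType.Exports.
Local Open Scope classical_set_scope.
Local Open Scope ring_scope.

Section Defs.
Variable R : realType.

Definition cosh (x : R) : R := (expR x + expR (- x)) / 2.
Definition sinh (x : R) : R := (expR x - expR (- x)) / 2.

(* Euler Gamma function, Gamma(x) = int_0^oo t^(x-1) e^(-t) dt  (used for x > 0) *)
Definition Gamma (x : R) : R :=
  Rintegral lebesgue_measure `]0%R, +oo[ (fun t : R => t `^ (x - 1) * expR (- t)).

Definition poch (a : R) (k : nat) : R := \prod_(i < k) (a + i%:R).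

(* Gauss hypergeometric series 2F1(a,b;c;x) (sum of the series, |x| < 1) *)
Definition hyp2F1 (a b c x : R) : R :=
  limn (series (fun k : nat => poch a k * poch b k / (poch c k * k`!%:R) * x ^+ k)).

Definition hyp2F1reg (a b c x : R) : R := hyp2F1 a b c x / Gamma c.

Definition LegendreQ (nu z : R) : R :=
  Num.sqrt pi * Gamma (nu + 1) / (2 `^ (nu + 1) * z `^ (nu + 1))
  * hyp2F1reg ((nu + 2) / 2) ((nu + 1) / 2) (nu + 3 / 2) (z ^- 2).

(* Legendre polynomial via Rodrigues' formula: P_n = 1/(2^n n!) d^n/dx^n (x^2-1)^n *)
Definition legendreP (n : nat) : {poly R} :=
  (2 ^+ n * n`!%:R)^-1 *: (('X ^+ 2 - 1) ^+ n)^`(n).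

Definition Ferrers (m n : nat) (x : R) : R :=
  (-1) ^+ m * Num.sqrt (1 - x ^+ 2) ^+ m * ((legendreP n)^`(m)).[x].

Definition chi (sigma sigma' theta theta' : R) : R :=
  let s := cosh sigma in let s' := cosh sigma' in
  let tau := cos theta in let tau' := cos theta' in
  ((sin theta) ^+ 2 * (s' - tau') ^+ 2 + (sin theta') ^+ 2 * (s - tau) ^+ 2
   + ((s' - tau') * sinh sigma - (s - tau) * sinh sigma') ^+ 2)
  / (2 * sin theta * sin theta' * (s - tau) * (s' - tau')).

End Defs.

(* Main.v *)
Require Import Defs.
From HB Require Import structures.
From mathcomp Require Import all_boot all_order all_algebra.
From mathcomp Require Import all_classical all_reals all_analysis.
From mathcomp Require Import measurable_realfun.
From mathcomp Require Import ring lra zify.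
Set Implicit Arguments.
Unset Strict Implicit.
Unset Printing Implicit Defensive.
Import Order.TTheory GRing.Theory Num.Theory.
Import numFieldNormedType.Exports.
Local Open Scope classical_set_scope.
Local Open Scope ring_scope.

(** With [C = cosh (sigma - sigma')] one has
    [chi = (C - cos th cos th') / (sin th sin th')], and Heine's formula
    [Q_(m-1/2)(z) = int_0^pi cos (m psi) / sqrt (2 (z - cos psi)) dpsi] turns the
    integral into the action on a spherical harmonic of degree [n] of the zonal
    kernel [1 / sqrt (2 (C - t))], where
    [t = cos th cos th' + sin th sin th' cos psi].  By the Funk-Hecke principle the
    result is that harmonic times the integral of [P_n(t) / sqrt (2 (C - t))] over
    [[-1, 1]], which is [2 rho^(n+1/2) / (2n+1)] for [rho = exp (-|sigma - sigma'|)].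

    Funk-Hecke is proved for [t^j]: its [m]-th Fourier coefficient in [psi] is an
    explicit kernel on which the Gegenbauer operators in [cos th] and [cos th'] agree,
    so integrating it against [P_n^(m)] gives a polynomial eigenfunction, and such
    eigenfunctions are determined by their value at [1].  It passes to
    [1 / sqrt (2 (C - t))], [C > 1], through the uniformly convergent binomial series.
    The singular case [C = 1] follows by letting [C] decrease to [1]: [Q_(m-1/2)] is
    positive and decreasing, monotone convergence for [n = m] gives integrability, and
    dominated convergence gives the value for every [n]. *)

(** Reduces a goal to a known equation whose sides have the same difference; [ring_from] leaves that
    polynomial identity to [ring]. *)
Lemma eq_of_subr (V : zmodType) (a b x y : V) : a = b -> x - y = a - b -> x = y.
Proof. by move=> -> /eqP; rewrite subrr subr_eq0 => /eqP. Qed.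

Ltac ring_from H := apply: (eq_of_subr H); ring.

Notation intpi f := (Rintegral lebesgue_measure `[0%R, pi] f).

(** * Integrals of continuous functions over [[0, pi]] *)

Section IntegralZeroPi.
Variable R : realType.
Implicit Types f g F : R -> R.

Lemma integrable_continuous f : continuous f ->
  lebesgue_measure.-integrable `[0%R, pi] (EFin \o f).
Proof.
move=> cf; apply: continuous_compact_integrable; first exact: segment_compact.
by apply: continuous_subspaceT.
Qed.

Lemma intpiD f g : continuous f -> continuous g ->
  intpi (fun x => f x + g x) = intpi f + intpi g.
Proof. by move=> cf cg; apply: RintegralD => //; exact: integrable_continuous. Qed.

Lemma intpiB f g : continuous f -> continuous g ->
  intpi (fun x => f x - g x) = intpi f - intpi g.
Proof. by move=> cf cg; apply: RintegralB => //; exact: integrable_continuous. Qed.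

Lemma intpiZ c f : continuous f -> intpi (fun x => c * f x) = c * intpi f.
Proof. by move=> cf; apply: RintegralZl => //; exact: integrable_continuous. Qed.

Lemma eq_intpi f g : (forall x, 0 <= x <= pi -> f x = g x) -> intpi f = intpi g.
Proof. by move=> fg; apply: eq_Rintegral => x; rewrite inE/= in_itv/= => /fg. Qed.

Lemma intpi_cst c : intpi (fun=> c : R) = c * pi.
Proof.
have E : fine (lebesgue_measure (`[0%R, pi]%classic : set R)) = pi.
  by rewrite lebesgue_measure_itv/= lte_fin pi_gt0/= oppr0 addr0.
by rewrite Rintegral_cst//; exact: (congr1 ( *%R c) E).
Qed.

Lemma intpi0 : intpi (fun=> 0 : R) = 0.
Proof. by rewrite intpi_cst mul0r. Qed.

Lemma continuous_sum (I : Type) (s : seq I) (F : I -> R -> R) :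
  (forall i, continuous (F i)) -> continuous (fun x => \sum_(i <- s) F i x).
Proof.
move=> cF; elim: s => [|i s IH] x.
  by rewrite (_ : (fun _ => _) = fun=> 0); [exact: cvg_cst|apply/funext => y; rewrite big_nil].
rewrite (_ : (fun _ => _) = fun y => F i y + \sum_(i <- s) F i y).
  by apply: cvgD; [exact: cF|exact: IH].
by apply/funext => y; rewrite big_cons.
Qed.

Lemma intpi_sum (I : Type) (s : seq I) (F : I -> R -> R) :
  (forall i, continuous (F i)) ->
  intpi (fun x => \sum_(i <- s) F i x) = \sum_(i <- s) intpi (F i).
Proof.
move=> cF; elim: s => [|i s IH].
  by rewrite big_nil -[RHS]intpi0; apply: eq_intpi => x _; rewrite big_nil.
rewrite big_cons -IH -intpiD//; last exact: continuous_sum.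
by apply: eq_intpi => x _; rewrite big_cons.
Qed.

Lemma norm_intpi_le f c : continuous f ->
  (forall x, 0 <= x <= pi -> `|f x| <= c) -> `|intpi f| <= c * pi.
Proof.
move=> cf fc; rewrite (le_trans (le_normr_Rintegral _ (integrable_continuous cf)))//.
rewrite -intpi_cst; apply: le_Rintegral => //.
- apply: integrable_continuous => x; apply: cvg_norm; exact: cf.
- by apply: integrable_continuous => x; exact: cvg_cst.
Qed.

Lemma intpi_deriv F f : continuous f -> (forall x : R, is_derive x 1 F (f x)) ->
  intpi f = F pi - F 0.
Proof.
move=> cf dF; have cF : continuous F.
  by move=> x; apply: differentiable_continuous; apply/derivable1_diffP; exact: ex_derive.
rewrite /Rintegral (@continuous_FTC2 _ f F 0 pi (pi_gt0 R))//.
- by apply: continuous_subspaceT.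
- split => [x _||]; first exact: ex_derive.
  + by apply: cvg_at_right_filter; exact: cF.
  + by apply: cvg_at_left_filter; exact: cF.
- by move=> x _; rewrite derive1E; exact: derive_val.
Qed.

End IntegralZeroPi.

(** * Polynomials integrated over [[-1, 1]] through the substitution by the cosine *)

Section PolynomialIntegral.
Variable R : realType.
Implicit Types (p q f g : {poly R}) (n m k : nat).

(** The integral of [p] over [[-1, 1]], in the variable [cos x]. *)
Definition Lam p : R := intpi (fun x => p.[cos x] * sin x).

Lemma continuous_horner_cos p : continuous (fun x : R => p.[cos x]).
Proof.
move=> x; apply: (@continuous_comp _ _ _ cos (horner p)).
  exact: continuous_cos.
by apply: differentiable_continuous; apply/derivable1_diffP; exact: ex_derive.
Qed.

Lemma continuous_horner_cos_sin p : continuous (fun x : R => p.[cos x] * sin x).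
Proof.
move=> x; apply: cvgM; first exact: continuous_horner_cos.
exact: continuous_sin.
Qed.

Lemma LamD p q : Lam (p + q) = Lam p + Lam q.
Proof.
rewrite /Lam -intpiD; [|exact: continuous_horner_cos_sin..].
by apply: eq_intpi => x _; rewrite hornerD mulrDl.
Qed.

Lemma LamZ c p : Lam (c *: p) = c * Lam p.
Proof.
rewrite /Lam -intpiZ; last exact: continuous_horner_cos_sin.
by apply: eq_intpi => x _; rewrite hornerZ mulrA.
Qed.

Lemma Lam0 : Lam 0 = 0.
Proof. by rewrite -(scale0r (0 : {poly R})) LamZ mul0r. Qed.

Lemma LamN p : Lam (- p) = - Lam p.
Proof. by rewrite -scaleN1r LamZ mulN1r. Qed.

Lemma Lam_sum (I : Type) (s : seq I) (F : I -> {poly R}) :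
  Lam (\sum_(i <- s) F i) = \sum_(i <- s) Lam (F i).
Proof.
elim: s => [|i s IH]; first by rewrite !big_nil Lam0.
by rewrite !big_cons LamD IH.
Qed.

Lemma Lam_deriv p : Lam p^`() = p.[1] - p.[-1].
Proof.
have H (x : R) : is_derive x 1 (fun x => - p.[cos x]) (p^`().[cos x] * sin x).
  have H : is_derive x 1 (horner p \o cos) (p^`().[cos x] * - sin x).
    exact: is_derive1_comp.
  by apply: (is_derive_eq (is_deriveN H)); rewrite mulrN opprK.
rewrite /Lam (intpi_deriv _ H); last exact: continuous_horner_cos_sin.
by rewrite cospi cos0 opprK addrC.
Qed.

End PolynomialIntegral.

(** * Gegenbauer operators and the derivatives of the Legendre polynomials *)

Section LegendreAlgebra.
Variable R : realType.
Implicit Types (p q f g : {poly R}) (n m k : nat).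

Local Notation P := (@legendreP R).

Definition sqX1 : {poly R} := 'X ^+ 2 - 1.

Lemma deriv_sqX1 : sqX1^`() = 'X *+ 2.
Proof. by rewrite /sqX1 derivB derivXn -polyC1 derivC subr0 /= expr1. Qed.

(** For [u = sqX1 ^+ n] this is the relation [sqX1 * u' = 2 n X u], differentiated [k + 1] times. *)
Lemma derivn_sqX1_ode n k :
  sqX1 * (sqX1 ^+ n)^`(k.+2)
  + (2 * k.+1%:R - 2 * n%:R)%:P * 'X * (sqX1 ^+ n)^`(k.+1)
  + (k.+1%:R * (k%:R - 2 * n%:R))%:P * (sqX1 ^+ n)^`(k) = 0.
Proof.
elim: k => [|k IH].
  have H : sqX1 * (sqX1 ^+ n)^`() = (2 * n%:R)%:P * 'X * sqX1 ^+ n.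
    case: n => [|n]; first by rewrite !expr0 -polyC1 derivC mulr0 mulr0 polyC0 !mul0r.
    rewrite deriv_exp deriv_sqX1 /= exprS polyCM.
    by ring.
  have := congr1 (@deriv R) H.
  rewrite !(derivM, derivC, derivX) deriv_sqX1 !derivnS derivn0 => H2.
  ring_from H2.
have := congr1 (@deriv R) IH.
rewrite !(deriv_sqX1, derivD, derivM, derivC, derivX) -!derivnS => H.
ring_from H.
Qed.

Definition wt : {poly R} := 1 - 'X ^+ 2.

Lemma deriv_wt : wt^`() = - ('X *+ 2).
Proof. by rewrite /wt derivB derivXn -polyC1 derivC sub0r /= expr1. Qed.

Lemma wtE x : wt.[x] = 1 - x ^+ 2.
Proof. by rewrite /wt !hornerE. Qed.

(** The Gegenbauer operator of parameter [m + 1/2], whose natural weight on [[-1, 1]] is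
    [wt ^+ m]. *)
Definition gegen m q : {poly R} :=
  wt * q^`()^`() - (2 * m.+1%:R)%:P * 'X * q^`().

(** Equal to [n (n + 1) - m (m + 1)], the eigenvalue of [- gegen m] on [P_n^(m)]. *)
Definition eig m n : R := (n%:R - m%:R) * (n%:R + m%:R + 1).

Lemma derivn_legendreP m n :
  (P n)^`(m) = (2 ^+ n * n`!%:R)^-1 *: (sqX1 ^+ n)^`(n + m).
Proof. by rewrite /legendreP derivnZ addnC; congr (_ *: _); rewrite /derivn iterD. Qed.

Lemma legendreP_ode m n : gegen m (P n)^`(m) = - (eig m n)%:P * (P n)^`(m).
Proof.
rewrite derivn_legendreP /gegen !derivZ -!derivnS -!mul_polyC /eig.
have H := derivn_sqX1_ode n (n + m).
have S : wt = - sqX1 by rewrite /sqX1 /wt; ring.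
rewrite S; apply/eqP; rewrite -subr_eq0; apply/eqP.
transitivity (- (2 ^+ n * n`!%:R)^-1%:P * (0 : {poly R})); last by rewrite mulr0.
rewrite -H; ring.
Qed.

(** Integration by parts: [wt ^+ m * gegen m g] is the derivative of [wt ^+ m.+1 * g'], and the
    boundary terms vanish because [wt] is zero at [1] and [-1]. *)
Lemma gegen_ibp m f g :
  Lam (wt ^+ m * f * gegen m g)
  = - Lam (wt ^+ m.+1 * f^`() * g^`()).
Proof.
apply/eqP; rewrite -addr_eq0 -LamD; apply/eqP.
have -> : wt ^+ m * f * gegen m g + wt ^+ m.+1 * f^`() * g^`()
    = (wt ^+ m.+1 * f * g^`())^`().
  rewrite !derivM deriv_exp deriv_wt /gegen /= !exprS; ring.
by rewrite Lam_deriv !hornerM !horner_exp !wtE sqrrN expr1n subrr !exprS !mul0r subrr.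
Qed.

Lemma gegen_sym m f g :
  Lam (wt ^+ m * f * gegen m g) = Lam (wt ^+ m * gegen m f * g).
Proof.
rewrite gegen_ibp mulrAC [in RHS]mulrAC gegen_ibp.
by congr (- Lam _); rewrite mulrAC.
Qed.

Lemma derivn_gegen m (l : R) q k : gegen m q = l%:P * q ->
  wt * q^`(k.+2) - (2 * (k + m).+1%:R)%:P * 'X * q^`(k.+1)
  = (l + k%:R * (k%:R - 1) + 2 * m.+1%:R * k%:R)%:P * q^`(k).
Proof.
move=> E; elim: k => [|k IH].
  rewrite !derivnS derivn0; move: E; rewrite /gegen => E; ring_from E.
have := congr1 (@deriv R) IH.
rewrite !(deriv_wt, derivD, derivN, derivM, derivC, derivX) -!derivnS => H.
ring_from H.
Qed.

(** At [1] the factor [wt] vanishes, so the [k]-th differentiated equation expresses [q^(k+1)(1)]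
    through [q^(k)(1)], with a nonzero coefficient. All Taylor coefficients at [1] are therefore
    zero. *)
Lemma gegen_eigen0 m (l : R) q : gegen m q = l%:P * q -> q.[1] = 0 -> q = 0.
Proof.
move=> E q1; have H k : (q^`(k)).[1] = 0.
  elim: k => [//|k IH].
  have := congr1 (fun p => p.[1]) (derivn_gegen k E).
  rewrite !(wtE, hornerM, hornerD, hornerN, hornerC, hornerX) expr1n.
  rewrite subrr mul0r IH mulr0 add0r mulr1 => /eqP.
  by rewrite oppr_eq0 mulf_eq0 mulf_eq0 !pnatr_eq0 /= => /eqP.
have N k : (q^`N(k)).[1] = 0.
  have := H k; rewrite nderivn_def hornerMn => /eqP.
  by rewrite mulrn_eq0 -leqn0 leqNgt fact_gt0 /= => /eqP.
have Q x : q.[x] = 0.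
  have := @nderiv_taylor R q 1 (x - 1) (commr_sym (commr1 _)).
  rewrite addrC subrK => ->.
  by rewrite big1 // => i _; rewrite N mul0r.
(* A nonzero [q] has fewer than [size q] roots, yet every natural number below [size q] would be
   one. *)
apply/eqP/negPn/negP => q0.
have := @max_poly_roots R q [seq i%:R | i <- iota 0 (size q)] q0.
rewrite size_map size_iota ltnn => H2; suff: false by []; apply: H2.
  by apply/allP => x _; rewrite rootE Q.
by rewrite map_inj_uniq ?iota_uniq // => i j /eqP; rewrite eqr_nat => /eqP.
Qed.

Lemma gegen_eigen_proportional m (l : R) p q :
  gegen m p = l%:P * p -> gegen m q = l%:P * q -> p.[1] *: q = q.[1] *: p.
Proof.
move=> Ep Eq; apply/eqP; rewrite -subr_eq0; apply/eqP.
apply: (@gegen_eigen0 m l); last by rewrite !hornerE mulrC subrr.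
apply: (@eq_of_subr _ (p.[1]%:P * gegen m q - q.[1]%:P * gegen m p)
  (p.[1]%:P * (l%:P * q) - q.[1]%:P * (l%:P * p))); first by rewrite Ep Eq.
by rewrite /gegen !derivB !derivZ -!mul_polyC; ring.
Qed.

(** * The products [(1 - x^2)^k x^l] and the symmetry of the zonal kernel *)

Definition zonal (k l : nat) : {poly R} := wt ^+ k * 'X ^+ l.

(** The value of [2 k + l] is the same in all three terms, so on the family with [2 k + l = N] the
    operator is tridiagonal. Where [k.-1] or [l.-2] is truncated, its coefficient is zero. *)
Lemma gegen_zonal m k l : gegen m (zonal k l) =
  (4 * k%:R * (m + k)%:R) *: zonal k.-1 l.+2
  - (2 * k%:R * l.+1%:R + 2 * l%:R * (m + k).+1%:R) *: zonal k l
  + (l%:R * (l%:R - 1)) *: zonal k.+1 l.-2.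
Proof.
rewrite /gegen /zonal -!mul_polyC.
case: k => [|[|k]]; case: l => [|[|l]];
  rewrite !(derivMn, deriv_exp, derivM, deriv_wt, derivD, derivN, derivX, derivC) /=;
  rewrite ?(derivMn, deriv_exp, derivM, deriv_wt, derivD, derivN, derivX, derivC) /= ?exprS; ring.
Qed.

(** Up to a common factor, the coefficients of the azimuthal Fourier coefficient computed in
    [azim_Xn_ge]. *)
Definition zonal_coef m N k : R := (4 ^+ k * (m + k)`!%:R * k`!%:R * (N - k.*2)`!%:R)^-1.

(** The balance relation that makes the tridiagonal matrix of [gegen m] symmetric for the weights
    [zonal_coef]. *)
Lemma zonal_coefS m N k : (k.*2.+2 <= N)%N ->
  zonal_coef m N k.+1 * (4 * k.+1%:R * (m + k.+1)%:R)
  = zonal_coef m N k * ((N - k.*2)%:R * ((N - k.*2)%:R - 1)).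
Proof.
move=> kN; rewrite /zonal_coef.
have [l ->] : exists l, N = (k.*2.+2 + l)%N by exists (N - k.*2.+2)%N; rewrite subnKC.
rewrite (_ : (_ - k.+1.*2)%N = l); last by lia.
rewrite (_ : (_ - k.*2)%N = l.+2); last by lia.
rewrite addnS !factS !exprS !natrM.
have H j : (j`!%:R : R) != 0 by rewrite pnatr_eq0 -lt0n fact_gt0.
have S j : (j.+1%:R : R) != 0 by rewrite pnatr_eq0.
have F4 : (4 ^+ k : R) != 0 by rewrite expf_neq0// pnatr_eq0.
field.
rewrite ?H ?S ?F4 /=; repeat (apply/andP; split => //);
  by rewrite -?natrD -?natr1 -?natr1 ?natrD pnatr_eq0; lia.
Qed.

(** Weighted by [g] the matrix is symmetric, so it may act on the numbers [L k] instead of the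
    vectors [u k]. The vanishing of [a 0] and [c K] removes the terms that would leave the index
    range. *)
Lemma tridiag_sum_sym (K : nat) (g L a b c : nat -> R) (u : nat -> {poly R}) :
  a 0%N = 0 -> c K = 0 ->
  (forall k, (k < K)%N -> g k.+1 * a k.+1 = g k * c k) ->
  \sum_(k < K.+1) (g k * L k) *: (a k *: u k.-1 - b k *: u k + c k *: u k.+1)
  = \sum_(k < K.+1) (g k * (a k * L k.-1 - b k * L k + c k * L k.+1)) *: u k.
Proof.
move=> a0 cK gac.
have E1 : \sum_(k < K.+1) (g k * L k * a k) *: u k.-1
    = \sum_(k < K.+1) (g k * c k * L k.+1) *: u k.
  rewrite big_ord_recl big_ord_recr /= a0 cK !(mulr0, mul0r) !scale0r add0r addr0.
  by apply: eq_bigr => k _ /=; rewrite -gac //= mulrAC.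
have E2 : \sum_(k < K.+1) (g k * L k * c k) *: u k.+1
    = \sum_(k < K.+1) (g k * a k * L k.-1) *: u k.
  rewrite big_ord_recr [in RHS]big_ord_recl /= a0 cK !(mulr0, mul0r) !scale0r add0r addr0.
  by apply: eq_bigr => k _ /=; rewrite gac //= mulrAC.
transitivity (\sum_(k < K.+1) (g k * L k * a k) *: u k.-1
  - \sum_(k < K.+1) (g k * L k * b k) *: u k
  + \sum_(k < K.+1) (g k * L k * c k) *: u k.+1).
  rewrite -sumrB -big_split /=; apply: eq_bigr => k _.
  by rewrite scalerDr scalerBr !scalerA.
rewrite E1 E2 -sumrB -big_split /=; apply: eq_bigr => k _.
by rewrite -scalerBl -scalerDl; congr (_ *: _); ring.
Qed.

(** Up to a constant, the sum over [k] below is the integral of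
    [wt ^+ m * P_n^(m)] against the [m]-th Fourier coefficient in [psi] of
    [(x y + sqrt (1 - x^2) sqrt (1 - y^2) cos psi) ^ (m + N)]. *)
Definition zonal_transform m n N : {poly R} :=
  \sum_(k < N./2.+1) (zonal_coef m N k
     * Lam (wt ^+ m * (P n)^`(m) * zonal k (N - k.*2))) *: zonal k (N - k.*2).

Lemma gegenD m p q : gegen m (p + q) = gegen m p + gegen m q.
Proof. by rewrite /gegen !derivD; ring. Qed.

Lemma gegenZ m c p : gegen m (c *: p) = c *: gegen m p.
Proof. by rewrite /gegen !derivZ -!mul_polyC; ring. Qed.

Lemma gegen_sum m (I : Type) (s : seq I) (F : I -> {poly R}) :
  gegen m (\sum_(i <- s) F i) = \sum_(i <- s) gegen m (F i).
Proof.
elim: s => [|i s IH]; first by rewrite !big_nil /gegen !deriv0 !mulr0 subrr.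
by rewrite !big_cons gegenD IH.
Qed.

(** By [tridiag_sum_sym] the operator passes from the outer variable to the integrated one, where
    [gegen_sym] moves it onto the eigenfunction [P_n^(m)]. *)
Lemma gegen_zonal_transform m n N :
  gegen m (zonal_transform m n N) = (- eig m n)%:P * zonal_transform m n N.
Proof.
pose l k := (N - k.*2)%N.
pose u k := zonal k (l k).
pose L k := Lam (wt ^+ m * (P n)^`(m) * u k).
pose a k : R := 4 * k%:R * (m + k)%:R.
pose b k : R := 2 * k%:R * (l k).+1%:R + 2 * (l k)%:R * (m + k).+1%:R.
pose c k : R := (l k)%:R * ((l k)%:R - 1).
have gu k : (k <= N./2)%N -> gegen m (u k) = a k *: u k.-1 - b k *: u k + c k *: u k.+1.
  move=> kN; rewrite /u gegen_zonal; congr (_ - _ + _).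
    case: k kN => [_|k kN]; first by rewrite /a !mulr0 mul0r !scale0r.
    by congr (_ *: zonal _ _); rewrite /l /=; lia.
  by congr (_ *: zonal _ _); rewrite /l /=; lia.
(* At the last index the exponent [N - 2 k] is [0] or [1]. *)
have cK : c N./2 = 0.
  have : (l N./2 == 0)%N || (l N./2 == 1)%N by rewrite /l; lia.
  by rewrite /c => /orP[] /eqP ->; rewrite ?subrr ?mulr0 ?mul0r.
have a0 : a 0%N = 0 by rewrite /a mulr0 mul0r.
have gac k : (k < N./2)%N -> zonal_coef m N k.+1 * a k.+1 = zonal_coef m N k * c k.
  by move=> kN; apply: zonal_coefS; lia.
rewrite /zonal_transform gegen_sum.
transitivity (\sum_(k < N./2.+1)
    (zonal_coef m N k * L k) *: (a k *: u k.-1 - b k *: u k + c k *: u k.+1)).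
  by apply: eq_bigr => k _; rewrite gegenZ -gu // -ltnS.
rewrite tridiag_sum_sym // mulr_sumr; apply: eq_bigr => k _.
rewrite [RHS]mul_polyC scalerA; congr (_ *: _).
have -> : a k * L k.-1 - b k * L k + c k * L k.+1 = Lam (wt ^+ m * (P n)^`(m) * gegen m (u k)).
  rewrite gu; last by rewrite -ltnS.
  rewrite /L -!LamZ -LamN -!LamD; congr Lam.
  by rewrite -!mul_polyC; ring.
rewrite gegen_sym legendreP_ode -/(u k) -/(L k).
have -> : wt ^+ m * (- (eig m n)%:P * (P n)^`(m)) * u k
    = (- eig m n) *: (wt ^+ m * (P n)^`(m) * u k).
  by rewrite -mul_polyC polyCN; ring.
by rewrite LamZ -/(L k); ring.
Qed.

(** * Recurrences and endpoint values of the Legendre polynomials *)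

Lemma derivn_add p i j : p^`(i + j) = p^`(i)^`(j).
Proof. by rewrite addnC /derivn iterD. Qed.

Lemma deriv2_sqX1 n : (sqX1 ^+ n.+2)^`(2) =
  (2 * n.+2%:R * (2 * n.+1%:R + 1)) *: sqX1 ^+ n.+1 + (4 * n.+1%:R * n.+2%:R) *: sqX1 ^+ n.
Proof.
rewrite !derivnS derivn0 !(derivMn, deriv_exp, derivM, deriv_sqX1, derivX) /=.
rewrite -!mul_polyC !exprS; have H : 'X * 'X = sqX1 + 1 by rewrite /sqX1; ring.
apply: (@eq_of_subr _ ((4 * n.+1%:R * n.+2%:R)%:P * sqX1 ^+ n * ('X * 'X))
  ((4 * n.+1%:R * n.+2%:R)%:P * sqX1 ^+ n * (sqX1 + 1))); first by rewrite H.
by ring.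
Qed.

Lemma derivn_mulX k f : ('X * f)^`(k.+1) = 'X * f^`(k.+1) + k.+1%:R *: f^`(k).
Proof.
elim: k => [|k IH]; first by rewrite !derivnS !derivn0 derivM derivX scale1r mul1r addrC.
rewrite derivnS IH derivD derivM derivX derivZ -!derivnS -!mul_polyC; ring.
Qed.

Let cP n : R := (2 ^+ n * n`!%:R)^-1.

Let cPS n : cP n = 2 * n.+1%:R * cP n.+1.
Proof.
rewrite /cP factS exprS natrM.
have H : (n`!%:R : R) != 0 by rewrite pnatr_eq0 -lt0n fact_gt0.
have F2 : (2 ^+ n : R) != 0 by rewrite expf_neq0// pnatr_eq0.
by field; rewrite H F2 nat1r pnatr_eq0.
Qed.

(** [W] is the normalised [n]-th derivative of [sqX1 ^+ n.+1], an antiderivative of [P_(n+1)]. The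
    first relation takes one of the [n + 2] derivatives of [sqX1 ^+ n.+2] first, the second takes
    two of them first. *)
Lemma legendrePSS n : exists W,
  P n.+2 = 'X * P n.+1 + n.+1%:R *: W /\ P n.+2 = (2 * n.+1%:R + 1) *: W + P n.
Proof.
exists (cP n.+1 *: (sqX1 ^+ n.+1)^`(n)); split.
  rewrite /legendreP -/sqX1 -!/(cP _) derivSn deriv_exp deriv_sqX1 succnK.
  rewrite (_ : 'X *+ 2 * sqX1 ^+ n.+1 *+ n.+2 = (2 * n.+2%:R) *: ('X * sqX1 ^+ n.+1)); last first.
    by rewrite -!mul_polyC; ring.
  rewrite derivnZ derivn_mulX scalerA.
  rewrite mulrC -cPS -!mul_polyC; ring.
rewrite /legendreP -/sqX1 -!/(cP _) -(addn2 n) addnC derivn_add addnC addn2 deriv2_sqX1.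
rewrite derivnD !derivnZ (cPS n) [in RHS](cPS n.+1) -!mul_polyC.
rewrite !polyCM; ring.
Qed.

(** Eliminates [W] between the two relations of [legendrePSS]. *)
Lemma legendreP_recurrence n :
  n.+2%:R *: P n.+2 = (2 * n.+1%:R + 1) *: ('X * P n.+1) - n.+1%:R *: P n.
Proof.
have [W [E1 E2]] := legendrePSS n.
apply: (@eq_of_subr _ ((2 * n.+1%:R + 1) *: P n.+2 - n.+1%:R *: P n.+2)
  ((2 * n.+1%:R + 1) *: ('X * P n.+1 + n.+1%:R *: W)
    - n.+1%:R *: ((2 * n.+1%:R + 1) *: W + P n))).
  by rewrite {1}E1 E2.
by rewrite -!mul_polyC; ring.
Qed.

(** Of the [n + 3] derivatives in [P_(n+2)'], two are spent on [deriv2_sqX1]; its two terms then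
    give [P_(n+1)] and [P_n']. *)
Lemma legendreP_deriv_recurrence n :
  (P n.+2)^`() - (P n)^`() = (2 * n.+1%:R + 1) *: P n.+1.
Proof.
rewrite -2!derivn1 !derivn_legendreP -!/(cP _).
rewrite [(n + 1)%N]addn1 (_ : (n.+2 + 1 = 2 + n.+1)%N); last by lia.
rewrite (derivn_add _ 2) deriv2_sqX1.
rewrite derivnD !derivnZ /legendreP -/sqX1 -/(cP n.+1) (cPS n.+1) (cPS n) (cPS n.+1).
rewrite -!mul_polyC !polyCM; ring.
Qed.

Lemma legendreP0 : P 0 = 1.
Proof. by rewrite /legendreP !expr0 mul1r invr1 scale1r derivn0. Qed.

Lemma legendreP1 : P 1 = 'X.
Proof.
rewrite /legendreP !expr1 mulr1 derivn1 -/sqX1 deriv_sqX1 -['X *+ 2]scaler_nat scalerA.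
by rewrite mulVf ?scale1r // pnatr_eq0.
Qed.

Lemma legendreP_at_sign (e : R) n : e ^+ 2 = 1 -> (P n).[e] = e ^+ n.
Proof.
move=> e2; suff : (P n).[e] = e ^+ n /\ (P n.+1).[e] = e ^+ n.+1 by case.
elim: n => [|n [IH1 IH2]]; first by rewrite legendreP0 legendreP1 hornerC hornerX.
split=> //; move: (legendreP_recurrence n) IH1 IH2.
move: (P n.+2) (P n.+1) (P n) => p2 p1 p0 /(congr1 (fun p => p.[e])) + IH1 IH2.
rewrite /= hornerD hornerN !hornerZ hornerM hornerX IH1 IH2.
rewrite (_ : e * e ^+ n.+1 = e ^+ n) => [H|]; last first.
  by rewrite !exprS mulrA -expr2 e2 mul1r.
rewrite (_ : e ^+ n.+2 = e ^+ n); last by rewrite !exprS mulrA -expr2 e2 mul1r.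
have n0 : (n.+2%:R : R) != 0 by rewrite pnatr_eq0.
by apply: (mulfI n0); ring_from H.
Qed.

Lemma legendreP_at1 n : (P n).[1] = 1.
Proof. by rewrite legendreP_at_sign expr1n. Qed.

Lemma derivn_legendreP_at1S m n :
  2 * m.+1%:R * ((P n)^`(m.+1)).[1] = eig m n * ((P n)^`(m)).[1].
Proof.
have := congr1 (fun p => p.[1]) (legendreP_ode m n).
rewrite /gegen /= !(wtE, hornerM, hornerD, hornerN, hornerC, hornerX) -derivnS expr1n.
by rewrite subrr mul0r add0r mulr1 mulNr => /oppr_inj.
Qed.

Lemma eig_neq0 m n : (m < n)%N -> eig m n != 0.
Proof.
move=> mn; rewrite /eig mulf_neq0 //; by rewrite subr_eq0 eqr_nat; lia.
Qed.

Lemma derivn_legendreP_at1_neq0 m n : (m <= n)%N -> ((P n)^`(m)).[1] != 0.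
Proof.
elim: m => [_|m IH mn]; first by rewrite derivn0 legendreP_at1 oner_eq0.
have := derivn_legendreP_at1S m n => /eqP; apply: contraTneq => ->.
by rewrite mulr0 eq_sym mulf_neq0 ?eig_neq0 // IH // ltnW.
Qed.

(** * Moments of [P_n^(m)] and the eigenvalue of the zonal kernel *)

Definition moment m n j := Lam (wt ^+ m * (P n)^`(m) * 'X ^+ j).

(** This is [gegen_ibp] with [f = 'X^j]: differentiating the monomial lowers [j] and raises [m],
    while [gegen m] multiplies [P_n^(m)] by its eigenvalue. *)
Lemma momentS m n j : j%:R * moment m.+1 n j.-1 = eig m n * moment m n j.
Proof.
have := gegen_ibp m 'X^j (P n)^`(m).
rewrite legendreP_ode (_ : _ * _ * (- _ * _)
    = (- eig m n) *: (wt ^+ m * (P n)^`(m) * 'X ^+ j)); last first.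
  by rewrite -mul_polyC polyCN; ring.
rewrite LamZ mulNr => /oppr_inj ->.
by rewrite /moment -LamZ derivXn -derivnS -mul_polyC; congr Lam; ring.
Qed.

(** Each use of [momentS] trades one power for one more derivative, and [eig m n] is nonzero as long
    as [m < n]. *)
Lemma moment_orth m n j : (m + j < n)%N -> moment m n j = 0.
Proof.
elim: j m => [|j IH] m mn; apply: (mulfI (@eig_neq0 m n _)); try lia; rewrite -momentS mulr0.
  by rewrite mul0r.
by rewrite IH ?mulr0 //; lia.
Qed.

(** Iterating [momentS] leads back to [m = 0]; the eigenvalue factors are absorbed by the ratios of
    consecutive values [P_n^(m)(1)]. *)
Lemma momentE m n N : moment m n N * (N + m)`!%:R
  = 2 ^+ m * m`!%:R * N`!%:R * ((P n)^`(m)).[1] * moment 0 n (N + m).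
Proof.
elim: m N => [|m IH] N.
  by rewrite addn0 expr0 derivn0 legendreP_at1 fact0; ring.
have N0 : (N.+1%:R : R) != 0 by rewrite pnatr_eq0.
apply: (mulfI N0); rewrite mulrA (momentS m n N.+1) -[LHS]mulrA.
rewrite (_ : (N + m.+1 = N.+1 + m)%N); last by lia.
rewrite IH.
have := derivn_legendreP_at1S m n => H.
rewrite !factS exprS !natrM.
pose c := N.+1%:R * N`!%:R * 2 ^+ m * m`!%:R * moment 0 n (N.+1 + m).
apply: (@eq_of_subr _ (c * (eig m n * ((P n)^`(m)).[1]))
  (c * (2 * m.+1%:R * ((P n)^`(m.+1)).[1]))).
  by rewrite H.
by rewrite /c; ring.
Qed.

Lemma moment0E n j : moment 0 n j = Lam ('X ^+ j * P n).
Proof. by rewrite /moment expr0 mul1r derivn0 mulrC. Qed.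

Lemma zonal_transform_at1 m n N :
  (zonal_transform m n N).[1] = moment m n N / (m`!%:R * N`!%:R).
Proof.
rewrite /zonal_transform horner_sum big_ord_recl big1 => [|k _].
  rewrite addr0 hornerZ /zonal_coef /zonal double0 subn0 addn0 !expr0 fact0 !mul1r mulr1.
  by rewrite hornerXn expr1n mulr1 mulrC.
by rewrite hornerZ /zonal hornerM horner_exp wtE expr1n subrr expr0n mul0r mulr0.
Qed.

(** The transform and [P_n^(m)] are eigenfunctions for the same eigenvalue, hence proportional. The
    factor is read off at [1], where only the term [k = 0] of the transform survives, and is
    evaluated by [momentE]. *)
Lemma zonal_transformE m n N : (m <= n)%N ->
  zonal_transform m n N
  = (2 ^+ m / (N + m)`!%:R * Lam ('X ^+ (N + m) * P n)) *: (P n)^`(m).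
Proof.
move=> mn; have p0 := derivn_legendreP_at1_neq0 mn.
have := gegen_eigen_proportional (l := - eig m n) _ (gegen_zonal_transform m n N).
move=> /(_ (P n)^`(m)); rewrite legendreP_ode polyCN => /(_ erefl) H.
apply: (scalerI p0); rewrite H scalerA; congr (_ *: _).
have F j : (j`!%:R : R) != 0 by rewrite pnatr_eq0 -lt0n fact_gt0.
have F1 : (m`!%:R * N`!%:R : R) != 0 by rewrite mulf_neq0.
rewrite zonal_transform_at1 -moment0E; apply: (mulIf F1); rewrite divfK //.
apply: (mulIf (F (N + m)%N)); rewrite momentE.
by field; exact: F.
Qed.

End LegendreAlgebra.

(** * Fourier coefficients of the powers of the cosine *)

Section CosineMoments.
Variable R : realType.

Definition cosmom (m i : nat) : R := intpi (fun x : R => cos (m%:R * x) * cos x ^+ i).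

Lemma continuous_cos_natmul m : continuous (fun x : R => cos (m%:R * x)).
Proof.
move=> x; apply: (@continuous_comp _ _ _ (fun x : R => m%:R * x) cos).
  by apply: cvgM; [exact: cvg_cst|exact: cvg_id].
exact: continuous_cos.
Qed.

Lemma continuous_cos_moment m i : continuous (fun x : R => cos (m%:R * x) * cos x ^+ i).
Proof.
move=> x; apply: cvgM; first exact: continuous_cos_natmul.
apply: (@continuous_comp _ _ _ cos (fun x : R => x ^+ i)); first exact: continuous_cos.
exact: exprn_continuous.
Qed.

Lemma cosmomSS m i : cosmom m.+1 i.+1 = (cosmom m.+2 i + cosmom m i) / 2.
Proof.
rewrite /cosmom -intpiD; [|exact: continuous_cos_moment..].
rewrite mulrC -intpiZ; last first.
  by move=> x; apply: cvgD; exact: continuous_cos_moment.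
apply: eq_intpi => x _.
rewrite (_ : m.+2%:R * x = m.+1%:R * x + x); last by ring.
rewrite (_ : m%:R * x = m.+1%:R * x - x); last by ring.
by rewrite cosD cosB exprS; field.
Qed.

Lemma cosmom0S i : cosmom 0 i.+1 = cosmom 1 i.
Proof. by apply: eq_intpi => x _; rewrite mul0r cos0 mul1r exprS mul1r. Qed.

Lemma sin_natmul_pi (k : nat) : sin (k%:R * pi : R) = 0.
Proof.
elim: k => [|k IH]; first by rewrite mul0r sin0.
by rewrite -natr1 mulrDl mul1r sinDpi IH oppr0.
Qed.

Lemma cosmom_0 m : cosmom m 0 = (m == 0%N)%:R * pi.
Proof.
case: m => [|m].
  by rewrite -intpi_cst; apply: eq_intpi => x _; rewrite mul0r cos0 expr0 mulr1.
rewrite mul0r.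
have m0 : (m.+1%:R : R) != 0 by rewrite pnatr_eq0.
have H (x : R) : is_derive x 1 (fun x : R => m.+1%:R^-1 * sin (m.+1%:R * x))
    (cos (m.+1%:R * x) * cos x ^+ 0).
  have H0 : is_derive x 1 (fun x : R => m.+1%:R * x) m.+1%:R.
    by apply: (is_derive_eq (@is_deriveZ _ _ _ id m.+1%:R x 1 1 _)); rewrite [_ *: _]mulr1.
  have H1 : is_derive x 1 (sin \o (fun x : R => m.+1%:R * x)) (cos (m.+1%:R * x) * m.+1%:R).
    exact: is_derive1_comp.
  apply: (is_derive_eq (is_deriveZ _ H1)).
  by rewrite /GRing.scale /= expr0 mulr1 mulrC mulfK.
rewrite /cosmom (intpi_deriv _ H) ?sin_natmul_pi ?mulr0 ?sin0 ?mulr0 ?subrr //.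
exact: continuous_cos_moment.
Qed.

Lemma cosmom_eq0 m i : (i < m)%N || odd (i + m) -> cosmom m i = 0.
Proof.
elim: i m => [|i IH] [|m] //= H.
- by rewrite cosmom_0 mul0r.
- by rewrite cosmom0S IH //; lia.
- by rewrite cosmomSS !IH ?addr0 ?mul0r //; lia.
Qed.

(** Under induction on the exponent, the product-to-sum relation [cosmomSS] becomes Pascal's
    rule. *)
Lemma cosmomE m k : cosmom m (m + k.*2) = pi * 'C(m + k.*2, k)%:R / 2 ^+ (m + k.*2).
Proof.
have [i Ei] : exists i, i = (m + k.*2)%N by eexists.
rewrite -Ei; elim: i m k Ei => [|i IH] [|m] k //.
- by case: k => // _; rewrite cosmom_0 bin0 expr0 mul1r mulr1 divr1.
- case: k => // k; rewrite add0n doubleS => -[Ei].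
  (* For [m = 0] the two terms of Pascal's rule coincide, by the symmetry of the binomial
     coefficients. *)
  rewrite cosmom0S (IH 1%N k); last by rewrite Ei.
  rewrite Ei binS (_ : 'C(k.*2.+1, k.+1) = 'C(k.*2.+1, k)); last first.
    by rewrite -[in RHS]bin_sub; [congr binomial|]; lia.
  rewrite natrD [in RHS]exprS; have : (2 ^+ k.*2.+1 : R) != 0 by rewrite expf_neq0 // pnatr_eq0.
  by move=> H; field.
- rewrite addSn => -[Ei]; rewrite cosmomSS (IH m k) // exprS.
  have H : (2 ^+ i : R) != 0 by rewrite expf_neq0 // pnatr_eq0.
  case: k Ei => [|k] Ei.
    by rewrite cosmom_eq0 ?bin0; [field|lia].
  by rewrite (IH m.+2 k) ?binS ?natrD; [field|lia].
Qed.

Lemma sum_ord_even (G : nat -> R) K : (forall k, G k.*2.+1 = 0) ->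
  \sum_(i < K.*2) G i = \sum_(k < K) G k.*2.
Proof.
move=> G0; elim: K => [|K IH]; first by rewrite !big_ord0.
by rewrite doubleS !big_ord_recr /= IH G0 addr0.
Qed.

Lemma sum_ord_even_half (G : nat -> R) N : (forall k, G k.*2.+1 = 0) ->
  \sum_(i < N.+1) G i = \sum_(k < N./2.+1) G k.*2.
Proof.
move=> G0; rewrite -sum_ord_even //; case: (boolP (odd N)) => oN.
  by rewrite (_ : N./2.+1.*2 = N.+1) //; lia.
rewrite (_ : N./2.+1.*2 = N.+2); last by lia.
rewrite [in RHS]big_ord_recr /= (_ : N.+1 = N./2.*2.+1); last by lia.
by rewrite G0 addr0.
Qed.

End CosineMoments.

(** * The binomial series of [(1 - t)^(-1/2)] with an explicit error bound *)

Section InverseSqrtSeries.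
Variable R : realType.

Definition bincoef j : R := poch 2^-1 j / j`!%:R.

Lemma pochS (a : R) k : poch a k.+1 = poch a k * (a + k%:R).
Proof. by rewrite /poch big_ord_recr. Qed.

Lemma poch0 (a : R) : poch a 0 = 1.
Proof. by rewrite /poch big_ord0. Qed.

Lemma poch_gt0 (a : R) k : 0 < a -> 0 < poch a k.
Proof. by move=> a0; apply: prodr_gt0 => i _; rewrite ltr_wpDr. Qed.

Lemma bincoefS j : j.+1%:R * bincoef j.+1 = (2^-1 + j%:R) * bincoef j.
Proof.
rewrite /bincoef pochS factS natrM.
have H : (j`!%:R : R) != 0 by rewrite pnatr_eq0 -lt0n fact_gt0.
by field; rewrite H nat1r pnatr_eq0.
Qed.

Lemma bincoef_ge0 j : 0 <= bincoef j.
Proof. by rewrite /bincoef divr_ge0 // ltW // poch_gt0 // invr_gt0. Qed.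

Lemma bincoef_le1 j : bincoef j <= 1.
Proof.
elim: j => [|j IH]; first by rewrite /bincoef poch0 fact0 divr1.
have j0 : 0 < j.+1%:R :> R by rewrite ltr0n.
rewrite -(ler_pM2l j0) bincoefS mulr1 -[j.+1%:R]natr1.
have j1 : 0 <= j%:R :> R by [].
have : 0 <= j%:R * (1 - bincoef j) by rewrite mulr_ge0 // subr_ge0.
lra.
Qed.

Definition binpoly J : {poly R} := \sum_(j < J) bincoef j *: 'X^j.

(** The function [(1 - t)^(-1/2)] solves [(1 - t) y' = y / 2]; its truncated series solves this up
    to one monomial of top degree. *)
Lemma binpoly_ode J : (1 - 'X) * (binpoly J.+1)^`() - 2^-1 *: binpoly J.+1
  = - ((2^-1 + J%:R) * bincoef J) *: 'X^J.
Proof.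
elim: J => [|J IH].
  rewrite /binpoly big_ord_recr big_ord0 /= add0r expr0 derivZ -polyC1 derivC scaler0 mulr0.
  by rewrite /bincoef poch0 fact0 divr1 addr0 mulr1 sub0r scale1r scaleNr.
have E : binpoly J.+2 = binpoly J.+1 + bincoef J.+1 *: 'X^(J.+1) by rewrite /binpoly big_ord_recr.
rewrite E derivD derivZ derivXn /=.
apply: (@eq_of_subr _ ((1 - 'X) * (binpoly J.+1)^`() - 2^-1 *: binpoly J.+1
   + ((J.+1%:R * bincoef J.+1)) *: 'X^J)
  (- ((2^-1 + J%:R) * bincoef J) *: 'X^J + ((2^-1 + J%:R) * bincoef J) *: 'X^J)).
  by rewrite IH bincoefS.
rewrite -!mul_polyC !exprS; ring.
Qed.

(** By [binpoly_ode], the product [g] of the partial sum with [sqrt (1 - t)] has a single monomial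
    over [sqrt (1 - t)] as derivative, and [g 0 = 1]. The mean value theorem bounds [g t - 1];
    dividing by [sqrt (1 - t)] supplies the second factor [1 / sqrt (1 - r)]. *)
Lemma binpoly_unif (r t : R) J : r < 1 -> `|t| <= r ->
  `|(binpoly J.+1).[t] - (Num.sqrt (1 - t))^-1| <= J.+1%:R * r ^+ J / (1 - r).
Proof.
move=> r1 tr.
have r0 : 0 <= r by rewrite (le_trans _ tr).
have pos (c : R) : `|c| <= r -> 0 < 1 - c by rewrite ler_norml; lra.
pose g (c : R) := (binpoly J.+1).[c] * Num.sqrt (1 - c).
pose dg (c : R) := - ((2^-1 + J%:R) * bincoef J) * c ^+ J / Num.sqrt (1 - c).
have dgP (c : R) : `|c| <= r -> is_derive c 1 g (dg c).
  move=> /pos c0.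
  have H1 : is_derive c 1 (fun x : R => 1 - x) (- 1).
    have H : is_derive c 1 (cst (1 : R) - id) (0 - 1) by exact: is_deriveB.
    by apply: (is_derive_eq H); rewrite sub0r.
  have H2 : is_derive c 1 (Num.sqrt \o (fun x : R => 1 - x)) ((2 * Num.sqrt (1 - c))^-1 * -1).
    by apply: is_derive1_comp; exact: is_derive1_sqrt.
  apply: (is_derive_eq (is_deriveM (is_derive_poly (binpoly J.+1) c) H2)).
  have := congr1 (fun p => p.[c]) (binpoly_ode J).
  rewrite /= !(hornerM, hornerD, hornerN, hornerZ, hornerX, hornerC, hornerXn).
  rewrite /GRing.scale /= /dg.
  have s0 : Num.sqrt (1 - c) != 0 by rewrite gt_eqF // sqrtr_gt0.
  have s2 : Num.sqrt (1 - c) ^+ 2 = 1 - c by rewrite sqr_sqrtr // ltW.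
  move: (binpoly J.+1).[c] ((binpoly J.+1)^`()).[c] => S S' H.
  rewrite -H; move: (Num.sqrt (1 - c)) s0 s2 => s s0 <-; field; exact: s0.
have dgB (c : R) : `|c| <= r -> `|dg c| <= J.+1%:R * r ^+ J / Num.sqrt (1 - r).
  move=> cr; rewrite /dg normrM normfV (ger0_norm (sqrtr_ge0 _)).
  apply: ler_pM => //.
  - rewrite normrM normrX; apply: ler_pM => //; last exact: lerXn2r.
    rewrite normrN ger0_norm; last by rewrite mulr_ge0 ?bincoef_ge0 // addr_ge0.
    have b1 := bincoef_le1 J; have b0 := bincoef_ge0 J; rewrite -[J.+1%:R]natr1.
    have J0 : 0 <= J%:R :> R by [].
    have : 0 <= J%:R * (1 - bincoef J) by rewrite mulr_ge0 // subr_ge0.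
    lra.
  - rewrite lef_pV2 ?posrE ?sqrtr_gt0 ?pos ?(ger0_norm r0) //.
    by apply: ler_wsqrtr; rewrite lerD2l lerN2 (le_trans (ler_norm _)).
have key : `|g t - 1| <= J.+1%:R * r ^+ J / Num.sqrt (1 - r).
  have g0 : g 0 = 1.
    rewrite /g subr0 sqrtr1 mulr1 /binpoly horner_sum big_ord_recl big1 => [|i _].
      by rewrite hornerZ hornerXn expr0 mulr1 addr0 /bincoef poch0 fact0 divr1.
    by rewrite hornerZ hornerXn expr0n mulr0.
  have B0 : 0 <= J.+1%:R * r ^+ J / Num.sqrt (1 - r).
    by rewrite divr_ge0 ?sqrtr_ge0 // mulr_ge0 // exprn_ge0.
  have cont (a b : R) : (forall x, x \in `[a, b] -> `|x| <= r) -> {within `[a, b], continuous g}.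
    by move=> H; apply: derivable_within_continuous => x /H /dgP[].
  rewrite -[X in g t - X]g0.
  move: tr; rewrite ler_norml => /andP[tr1 tr2].
  have [t0|t0] := leP 0 t.
    have := @MVT_segment _ g dg 0 t t0.
    case=> [x /itvP xI||c /itvP cI ->].
    + apply: dgP; rewrite ler_norml !ltW ?xI //; first by rewrite (lt_le_trans _ tr2) ?xI.
      by rewrite (le_lt_trans _ (_ : 0 < x)) ?xI ?oppr_le0.
    + apply: cont => x /itvP xI; rewrite ler_norml (le_trans _ (_ : 0 <= x)) ?xI ?oppr_le0 //=.
      by rewrite (le_trans _ tr2) ?xI.
    + rewrite subr0 normrM -[leRHS]mulr1; apply: ler_pM => //.
        apply: dgB; rewrite ler_norml (le_trans _ (_ : 0 <= c)) ?cI ?oppr_le0 //=.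
        by rewrite (le_trans _ tr2) ?cI.
      by rewrite ger0_norm // (le_trans tr2) ?ltW.
  have := @MVT_segment _ g dg t 0 (ltW t0).
  case=> [x /itvP xI||c /itvP cI E].
  + by apply: dgP; rewrite ler_norml (le_trans tr1) ?xI //= (le_trans _ r0) ?xI.
  + by apply: cont => x /itvP xI; rewrite ler_norml (le_trans tr1) ?xI //= (le_trans _ r0) ?xI.
  + rewrite distrC E sub0r normrM -[leRHS]mulr1; apply: ler_pM => //.
      by apply: dgB; rewrite ler_norml (le_trans tr1) ?cI //= (le_trans _ r0) ?cI.
    by rewrite normrN ltr0_norm //; lra.
have s0 : 0 < Num.sqrt (1 - t) by rewrite sqrtr_gt0 pos.
have -> : (binpoly J.+1).[t] - (Num.sqrt (1 - t))^-1 = (g t - 1) / Num.sqrt (1 - t).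
  by rewrite /g mulrBl mulfK ?gt_eqF // mul1r.
have -> : J.+1%:R * r ^+ J / (1 - r) = J.+1%:R * r ^+ J / Num.sqrt (1 - r) / Num.sqrt (1 - r).
  by rewrite -[RHS]mulrA -invfM -expr2 sqr_sqrtr // ltW // pos // ger0_norm.
rewrite normrM normfV (ger0_norm (ltW s0)) ler_pM // ?invr_ge0 ?(ltW s0) //.
rewrite lef_pV2 ?posrE ?sqrtr_gt0 ?pos ?(ger0_norm r0) //.
by apply: ler_wsqrtr; rewrite lerD2l lerN2 (le_trans (ler_norm _)).
Qed.

(** With [s = sqrt r], half of the decay controls the linear factor: [(J + 1) s^J] is at most the
    geometric sum, hence at most [1 / (1 - s)]. The other [s^J] tends to zero. *)
Lemma binerr_cvg0 (r : R) : 0 <= r < 1 -> (J.+1%:R * r ^+ J / (1 - r)) @[J --> \oo] --> (0 : R).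
Proof.
move=> /andP[r0 r1].
pose s := Num.sqrt r.
have s0 : 0 <= s by exact: sqrtr_ge0.
have s1 : s < 1 by rewrite -[ltRHS]sqrtr1 ltr_sqrt.
have sr : s ^+ 2 = r by rewrite sqr_sqrtr.
have bnd J : J.+1%:R * s ^+ J <= (1 - s)^-1.
  have s10 : 0 < 1 - s by lra.
  rewrite -(ler_pM2r s10) mulVf ?gt_eqF //.
  have H : J.+1%:R * s ^+ J * (1 - s) <= 1 - s ^+ J.+1.
    elim: J => [|J IH]; first by rewrite expr0 expr1 mul1r mul1r.
    rewrite -[J.+2%:R]natr1 [in leRHS]exprS [in leLHS]exprS.
    have : 0 <= s ^+ J by exact: exprn_ge0.
    have : s ^+ J <= 1 by rewrite exprn_ile1 // ltW.
    have : 0 <= J.+1%:R :> R by [].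
    move: IH; rewrite !exprS; move: (s ^+ J) (J.+1%:R : R) => u v IH v0 u1 u0.
    have h1 : 0 <= s * (1 - s * u - v * u * (1 - s)) by rewrite mulr_ge0 // subr_ge0.
    have h2 : 0 <= (1 - s) * (1 - s * u).
      by rewrite mulr_ge0 ?subr_ge0 ?(ltW s1) // mulr_ile1 // ltW.
    lra.
  by rewrite (le_trans H) // gerBl exprn_ge0.
apply: (@squeeze_cvgr _ _ _ _ (cst 0) (fun J => s ^+ J * ((1 - s)^-1 / (1 - r)))); last 2 first.
- exact: cvg_cst.
- rewrite -[X in _ --> X](mul0r ((1 - s)^-1 / (1 - r))); apply: cvgM; last exact: cvg_cst.
  by apply: cvg_expr; rewrite ger0_norm.
apply: nearW => J; apply/andP; split.
  by apply: divr_ge0; [rewrite mulr_ge0 // exprn_ge0|rewrite subr_ge0 ltW].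
rewrite mulrA ler_pM2r ?invr_gt0 ?subr_gt0 //.
by rewrite -sr -exprM mulnC exprM expr2 mulrA mulrC ler_wpM2l // exprn_ge0.
Qed.

End InverseSqrtSeries.

(** * Continuity and integrals under uniform limits *)

Section UniformLimits.
Variable R : realType.
Variables (f_ : nat -> R -> R) (f : R -> R) (e : nat -> R).
Hypothesis cf_ : forall n, continuous (f_ n).
Hypothesis e0 : e n @[n --> \oo] --> (0 : R).
Hypothesis fe : forall n x, `|f_ n x - f x| <= e n.

Lemma continuous_uniform_limit : continuous f.
Proof.
move=> x; apply/cvgrPdist_lt => eps eps0.
have e3 : 0 < eps / 3 by rewrite divr_gt0.
have [n _ /(_ n (leqnn n)) /= en] : \forall n \near \oo, `|0 - e n| < eps / 3.
  by move/cvgrPdist_lt : e0 => /(_ _ e3).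
have : \forall y \near x, `|f_ n x - f_ n y| < eps / 3.
  have H1 : f_ n y @[y --> x] --> f_ n x by exact: cf_.
  by move/cvgrPdist_lt : H1 => /(_ _ e3).
apply: filterS => y H.
have en' : e n < eps / 3 by move: en; rewrite sub0r normrN => /(le_lt_trans (ler_norm _)).
have E : f x - f y = (f_ n x - f_ n y) + (f x - f_ n x) + (f_ n y - f y) by ring.
rewrite E (le_lt_trans (ler_normD _ _)) //.
have := fe n y; have := fe n x; rewrite distrC => h1 h2.
have := ler_normD (f_ n x - f_ n y) (f x - f_ n x) => h3.
lra.
Qed.

Lemma cvg_intpi_uniform_limit : intpi (f_ n) @[n --> \oo] --> intpi f.
Proof.
have cf := continuous_uniform_limit.
apply/subr_cvg0; apply: norm_cvg0.
apply: (@squeeze_cvgr _ _ _ _ (cst 0) (fun n => e n * pi)); last 2 first.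
- exact: cvg_cst.
- by rewrite -[X in _ --> X](mul0r pi); apply: cvgM => //; exact: cvg_cst.
apply: nearW => n; apply/andP; split=> //=.
rewrite -intpiB //; apply: norm_intpi_le => [x|x _]; last exact: fe.
by apply: cvgB; [exact: cf_|exact: cf].
Qed.

End UniformLimits.

(** * The kernel [1 / sqrt (2 (C - t))], its polynomial approximations and Heine's integral *)

Section Kernel.
Variable R : realType.

(** For [C = (rho + 1 / rho) / 2] with [0 < rho < 1] this is [sqrt rho] times the generating
    function of the Legendre polynomials at [rho]. *)
Definition ker (C t : R) : R := (Num.sqrt (2 * (C - t)))^-1.

Definition kerpoly (C : R) J : {poly R} :=
  (Num.sqrt (2 * C))^-1 *: \sum_(j < J.+1) (bincoef R j * C^-1 ^+ j) *: 'X^j.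

(** The bound [binpoly_unif] at [t / C] with [r = 1 / C]; the prefactor [1 / sqrt (2 C)] is at most
    [1]. *)
Lemma kerpoly_unif (C t : R) J : 1 < C -> `|t| <= 1 ->
  `|(kerpoly C J).[t] - ker C t| <= J.+1%:R * C^-1 ^+ J / (1 - C^-1).
Proof.
move=> C1 t1; have C0 : 0 < C by rewrite (lt_trans _ C1).
have tC : `|t / C| <= C^-1.
  by rewrite normrM normfV (gtr0_norm C0) ler_piMl // invr_ge0 ltW.
have -> : (kerpoly C J).[t] = (Num.sqrt (2 * C))^-1 * (binpoly R J.+1).[t / C].
  rewrite /kerpoly /binpoly hornerZ !horner_sum; congr (_ * _); apply: eq_bigr => j _.
  by rewrite !hornerZ !hornerXn exprMn mulrAC mulrA.
have -> : ker C t = (Num.sqrt (2 * C))^-1 * (Num.sqrt (1 - t / C))^-1.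
  rewrite /ker -invfM -sqrtrM ?mulr_ge0 ?ltW //; congr (Num.sqrt _)^-1.
  by field; rewrite gt_eqF.
rewrite -mulrBr normrM ger0_norm ?invr_ge0 ?sqrtr_ge0 //.
rewrite -[leRHS]mul1r; apply: ler_pM => //.
- rewrite invf_le1 ?sqrtr_gt0 ?mulr_gt0 // -[leLHS]sqrtr1; apply: ler_wsqrtr; lra.
- by apply: binpoly_unif => //; rewrite invf_lt1.
Qed.

Lemma kerpoly_err_cvg0 (C : R) : 1 < C ->
  (J.+1%:R * C^-1 ^+ J / (1 - C^-1)) @[J --> \oo] --> (0 : R).
Proof.
move=> C1; have C0 : 0 < C by rewrite (lt_trans _ C1).
by apply: binerr_cvg0; rewrite invr_ge0 (ltW C0) invf_lt1.
Qed.

Lemma continuous_ker (C : R) (u : R -> R) : (forall x, u x < C) -> continuous u ->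
  continuous (fun x => ker C (u x)).
Proof.
move=> uC cu x; apply: cvgV.
  by rewrite gt_eqF // sqrtr_gt0 mulr_gt0 // subr_gt0.
apply: (@continuous_comp _ _ _ (fun x => 2 * (C - u x)) Num.sqrt); last exact: sqrt_continuous.
apply: cvgM; first exact: cvg_cst.
by apply: cvgB; [exact: cvg_cst|exact: cu].
Qed.

Definition heine m (z : R) := intpi (fun x : R => ker z (cos x) * cos (m%:R * x)).

Lemma normr_cos_le1 (x : R) : `|cos x| <= 1.
Proof. by rewrite ler_norml cos_geN1 cos_le1. Qed.

Lemma heine_series m z : 1 < z ->
  (Num.sqrt (2 * z))^-1 * (\sum_(j < J.+1) bincoef R j * z^-1 ^+ j * cosmom R m j)
    @[J --> \oo] --> heine m z.
Proof.
move=> z1.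
have cp J : continuous (fun x : R => (kerpoly z J).[cos x] * cos (m%:R * x)).
  by move=> x; apply: cvgM; [exact: continuous_horner_cos|exact: continuous_cos_natmul].
have := @cvg_intpi_uniform_limit R (fun J x => (kerpoly z J).[cos x] * cos (m%:R * x))
  (fun x => ker z (cos x) * cos (m%:R * x)) _ cp (kerpoly_err_cvg0 z1).
move=> H; rewrite (_ : (fun J => _) =
    fun J => intpi (fun x => (kerpoly z J).[cos x] * cos (m%:R * x))); last first.
  apply/funext => J.
  pose F (j : 'I_J.+1) (x : R) := bincoef R j * z^-1 ^+ j * (cos (m%:R * x) * cos x ^+ j).
  have cF j : continuous (F j).
    by move=> x; apply: cvgM; [exact: cvg_cst|exact: continuous_cos_moment].
  rewrite (eq_bigr (fun j => intpi (F j))) => [|j _]; last first.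
    by rewrite -intpiZ //; exact: continuous_cos_moment.
  rewrite -intpi_sum // -intpiZ; last exact: continuous_sum.
  apply: eq_intpi => x _; rewrite /kerpoly hornerZ horner_sum -mulrA; congr (_ * _).
  by rewrite mulr_suml; apply: eq_bigr => j _; rewrite /F hornerZ hornerXn; ring.
apply: H => J x; rewrite -mulrBl normrM -[leRHS]mulr1; apply: ler_pM => //.
  by apply: kerpoly_unif => //; exact: normr_cos_le1.
exact: normr_cos_le1.
Qed.

Lemma heine_series_even m z : 1 < z ->
  (Num.sqrt (2 * z))^-1 * (\sum_(k < K)
      bincoef R (m + k.*2) * z^-1 ^+ (m + k.*2) * cosmom R m (m + k.*2))
    @[K --> \oo] --> heine m z.
Proof.
move=> z1; rewrite -(cvg_shiftS (fun K => _)) /=.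
pose G J := (Num.sqrt (2 * z))^-1 * (\sum_(j < J.+1) bincoef R j * z^-1 ^+ j * cosmom R m j).
(* Stopping at [J = m + 2 K + 1] leaves, beyond the first [m] indices, [K + 1] pairs, each with one
   vanishing odd offset. *)
rewrite (_ : (fun K => _) = G \o (fun K => m + K.*2.+1)%N); last first.
  apply/funext => K; rewrite /G /=; congr (_ * _).
  rewrite -addnS -[K.*2.+2]/(K.+1.*2) big_split_ord /= [X in _ = X + _]big1 ?add0r => [|i _].
    symmetry; apply: (sum_ord_even (G := fun k =>
      bincoef R (m + k) * z^-1 ^+ (m + k) * cosmom R m (m + k))) => k.
    by rewrite cosmom_eq0 ?mulr0 //; lia.
  by rewrite cosmom_eq0 ?mulr0 // ltn_ord.
apply: cvg_comp; last exact: heine_series.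
by move=> A [N _ NA]; exists N => // K /= NK; apply: NA => /=; lia.
Qed.

(** By the spherical law of cosines, the cosine of the angle between points of colatitudes [th] and
    [th'] whose longitudes differ by [psi]. *)
Definition sphcos (th th' psi : R) : R := cos th * cos th' + sin th * sin th' * cos psi.

Lemma normr_sphcos_le1 th th' psi : `|sphcos th th' psi| <= 1.
Proof.
rewrite -(ler_pXn2r (ltn0Sn 1)) ?nnegrE // expr1n real_normK ?num_real // /sphcos.
have := cos2Dsin2 th; have := cos2Dsin2 th'; have := cos2Dsin2 psi.
move: (cos th) (sin th) (cos th') (sin th') (cos psi) (sin psi) => c s c' s' u v.
move=> h1 h2 h3.
(* The three squares are those of the coordinates of one unit vector in an orthonormal frame adapted
   to the other. *)
have E : (c * c' + s * s' * u) ^+ 2 + ((c * s' * u - s * c') ^+ 2 + (s' * v) ^+ 2) = 1.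
  transitivity ((c ^+ 2 + s ^+ 2) * (c' ^+ 2 + s' ^+ 2 * u ^+ 2) + s' ^+ 2 * v ^+ 2); first by ring.
  by rewrite h3 mul1r -addrA -mulrDr h1 mulr1 h2.
by rewrite -[leRHS]E lerDl addr_ge0 // sqr_ge0.
Qed.

Lemma continuous_sphcos th th' : continuous (sphcos th th').
Proof.
move=> x; apply: cvgD; first exact: cvg_cst.
by apply: cvgM; [exact: cvg_cst|exact: continuous_cos].
Qed.

End Kernel.

(** * The Funk-Hecke formula for polynomial kernels *)

Section FunkHecke.
Variable R : realType.
Local Notation P := (@legendreP R).
Implicit Types (q : {poly R}).

Definition azim q m (th th' : R) : R :=
  intpi (fun psi => q.[sphcos th th' psi] * cos (m%:R * psi)).

Lemma continuous_horner_comp q (u : R -> R) : continuous u -> continuous (fun x => q.[u x]).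
Proof.
move=> cu x; apply: (@continuous_comp _ _ _ u (horner q)); first exact: cu.
by apply: differentiable_continuous; apply/derivable1_diffP; exact: ex_derive.
Qed.

Lemma continuous_azim_integrand q m th th' :
  continuous (fun psi => q.[sphcos th th' psi] * cos (m%:R * psi)).
Proof.
move=> x; apply: cvgM; last exact: continuous_cos_natmul.
by apply: continuous_horner_comp; exact: continuous_sphcos.
Qed.

Lemma azimD q1 q2 m th th' : azim (q1 + q2) m th th' = azim q1 m th th' + azim q2 m th th'.
Proof.
rewrite /azim -intpiD; [|exact: continuous_azim_integrand..].
by apply: eq_intpi => x _; rewrite hornerD mulrDl.
Qed.

Lemma azimZ c q m th th' : azim (c *: q) m th th' = c * azim q m th th'.
Proof.
rewrite /azim -intpiZ; last exact: continuous_azim_integrand.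
by apply: eq_intpi => x _; rewrite hornerZ mulrA.
Qed.

Lemma azim_Xn j m th th' : azim 'X^j m th th' =
  \sum_(i < j.+1) (cos th * cos th') ^+ (j - i) * (sin th * sin th') ^+ i * 'C(j, i)%:R
    * cosmom R m i.
Proof.
pose F (i : 'I_j.+1) (x : R) := (cos th * cos th') ^+ (j - i) * (sin th * sin th') ^+ i
  * 'C(j, i)%:R * (cos (m%:R * x) * cos x ^+ i).
have cF i : continuous (F i).
  by move=> x; apply: cvgM; [exact: cvg_cst|exact: continuous_cos_moment].
rewrite (eq_bigr (fun j => intpi (F j))) => [|i _]; last first.
  by rewrite -intpiZ //; exact: continuous_cos_moment.
rewrite -intpi_sum //; apply: eq_intpi => x _.
rewrite hornerXn /sphcos exprDn mulr_suml; apply: eq_bigr => i _.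
by rewrite /F [(_ * cos x) ^+ _]exprMn -[_ *+ 'C(j, i)]mulr_natr; ring.
Qed.

Lemma azim_Xn_lt j m th th' : (j < m)%N -> azim 'X^j m th th' = 0.
Proof.
move=> jm; rewrite azim_Xn big1 // => i _.
by rewrite cosmom_eq0 ?mulr0 //; apply/orP; left; have := ltn_ord i; lia.
Qed.

Lemma wt_cos (th : R) : (wt R).[cos th] = sin th ^+ 2.
Proof. by rewrite wtE -(cos2Dsin2 th) addrC addKr. Qed.

(** Only the indices [m + 2 k] of the binomial expansion survive. There [sin^(2 k)] becomes
    [wt ^+ k], and the two binomial coefficients merge into [zonal_coef]. *)
Lemma azim_Xn_ge m N th th' : azim 'X^(m + N) m th th' =
  pi / 2 ^+ m * (m + N)`!%:R * (sin th * sin th') ^+ m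
  * \sum_(k < N./2.+1) zonal_coef R m N k
     * (zonal R k (N - k.*2)).[cos th'] * (zonal R k (N - k.*2)).[cos th].
Proof.
rewrite azim_Xn -addnS big_split_ord /= [X in X + _]big1 ?add0r => [|i _]; last first.
  by rewrite cosmom_eq0 ?mulr0 // ltn_ord.
pose G i := (cos th * cos th') ^+ (m + N - (m + i)) * (sin th * sin th') ^+ (m + i)
   * 'C(m + N, m + i)%:R * cosmom R m (m + i).
rewrite (sum_ord_even_half (G := G)) => [|k]; last first.
  by rewrite /G cosmom_eq0 ?mulr0 //; lia.
rewrite mulr_sumr; apply: eq_bigr => k _; rewrite /G cosmomE.
have kN : (k.*2 <= N)%N by have := ltn_ord k; lia.
have [l Nl] : exists l, N = (k.*2 + l)%N by exists (N - k.*2)%N; rewrite subnKC.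
rewrite (_ : (m + N - (m + k.*2))%N = l); last by lia.
rewrite /zonal_coef (_ : (N - k.*2)%N = l); last by lia.
have F j : (j`!%:R : R) != 0 by rewrite pnatr_eq0 -lt0n fact_gt0.
have E1 : 'C(m + N, m + k.*2)%:R * ((m + k.*2)`!%:R * l`!%:R) = (m + N)`!%:R :> R.
  have H : (m + k.*2 <= m + N)%N by lia.
  by rewrite -!natrM -(bin_fact H) (_ : (m + N - (m + k.*2))%N = l) //; lia.
have E2 : 'C(m + k.*2, k)%:R * (k`!%:R * (m + k)`!%:R) = (m + k.*2)`!%:R :> R.
  have H : (k <= m + k.*2)%N by lia.
  by rewrite -!natrM -(bin_fact H) (_ : (m + k.*2 - k)%N = (m + k)%N) //; lia.
rewrite -E1 -E2 /zonal !hornerM !horner_exp !hornerX !wt_cos.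
have T j : (2 ^+ j : R) != 0 by rewrite expf_neq0 // pnatr_eq0.
have -> : (4 ^+ k : R) = 2 ^+ k.*2 by rewrite -mul2n exprM; congr (_ ^+ k); ring.
rewrite -!exprM !mul2n !exprMn !exprD.
by field; rewrite !F !T.
Qed.

(** Both properties are linear in [q], so monomials suffice. The polynomial [Q] is made explicit
    because it also yields continuity in [th]. *)
Lemma azim_funk_hecke q m n th' : (m <= n)%N -> exists Q : {poly R},
  (forall th, azim q m th th' = sin th ^+ m * Q.[cos th]) /\
  Lam (wt R ^+ m * (P n)^`(m) * Q)
   = pi * sin th' ^+ m * ((P n)^`(m)).[cos th'] * Lam (q * P n).
Proof.
move=> mn; set p := (P n)^`(m).
pose good q := exists Q : {poly R},
  (forall th, azim q m th th' = sin th ^+ m * Q.[cos th]) /\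
  Lam (wt R ^+ m * p * Q) = pi * sin th' ^+ m * p.[cos th'] * Lam (q * P n).
have good0 : good 0.
  exists 0; rewrite mul0r mulr0 !Lam0 mulr0; split=> // th.
  by have := azimZ 0 0 m th th'; rewrite scale0r mul0r horner0 mulr0.
have goodD q1 q2 : good q1 -> good q2 -> good (q1 + q2).
  move=> [Q1 [H1 L1]] [Q2 [H2 L2]]; exists (Q1 + Q2); split=> [th|].
    by rewrite azimD H1 H2 hornerD mulrDr.
  by rewrite [_ * (Q1 + Q2)]mulrDr LamD L1 L2 [(q1 + q2) * _]mulrDl LamD mulrDr.
have goodZ c q1 : good q1 -> good (c *: q1).
  move=> [Q1 [H1 L1]]; exists (c *: Q1); split=> [th|].
    by rewrite azimZ H1 hornerZ mulrCA.
  by rewrite -(scalerAr c _ Q1) LamZ L1 -(scalerAl c q1) LamZ mulrCA.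
have goodX j : good 'X^j.
  have [jm|mj] := ltnP j m.
    exists 0; split=> [th|]; first by rewrite azim_Xn_lt // horner0 mulr0.
    (* A monomial of degree below [m <= n] is orthogonal to [P_n], so both sides vanish. *)
    by rewrite mulr0 Lam0 -moment0E moment_orth ?mulr0 // (leq_trans _ mn).
  have [N ->] : exists N, j = (m + N)%N by exists (j - m)%N; rewrite subnKC.
  pose c := pi / 2 ^+ m * (m + N)`!%:R * sin th' ^+ m.
  exists (c *: \sum_(k < N./2.+1) (zonal_coef R m N k * (zonal R k (N - k.*2)).[cos th'])
    *: zonal R k (N - k.*2)); split=> [th|].
    rewrite azim_Xn_ge hornerZ horner_sum /c exprMn.
    under [in RHS]eq_bigr do rewrite hornerZ.
    by ring.
  (* Integrating the kernel in [th] gives [zonal_transform] evaluated at [cos th']. *)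
  have := congr1 (fun r => r.[cos th']) (zonal_transformE R N mn).
  rewrite /= hornerZ /zonal_transform horner_sum => E.
  rewrite -scalerAr LamZ mulr_sumr Lam_sum.
  rewrite (eq_bigr (fun k : 'I_N./2.+1 => ((zonal_coef R m N k *
     Lam (wt R ^+ m * p * zonal R k (N - k.*2))) *: zonal R k (N - k.*2)).[cos th'])); last first.
    by move=> k _; rewrite -scalerAr LamZ hornerZ; ring.
  rewrite E /c -/p addnC.
  have F : ((N + m)`!%:R : R) != 0 by rewrite pnatr_eq0 -lt0n fact_gt0.
  have T : (2 ^+ m : R) != 0 by rewrite expf_neq0 // pnatr_eq0.
  by field; rewrite F T.
rewrite -/(good q) -[q]coefK poly_def; elim/big_ind : _ => // i _; exact: goodZ.
Qed.

Lemma sin_wt_horner (th : R) m (p Q : {poly R}) :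
  sin th ^+ m * Q.[cos th] * sin th ^+ m * p.[cos th] = (wt R ^+ m * p * Q).[cos th].
Proof. by rewrite !hornerM horner_exp wt_cos -exprM mul2n -addnn exprD; ring. Qed.

End FunkHecke.

(** * Integrals of Legendre polynomials against the kernel *)

Section RingKernel.
Variable R : realType.
Local Notation P := (@legendreP R).
Variables (C : R) (C1 : 1 < C).

Definition kerint (q : {poly R}) : R := intpi (fun x => ker C (cos x) * q.[cos x] * sin x).

Lemma continuous_ker_cos : continuous (fun x : R => ker C (cos x)).
Proof.
apply: continuous_ker; last exact: continuous_cos.
by move=> x; rewrite (le_lt_trans (cos_le1 _)).
Qed.

Lemma continuous_kerint (q : {poly R}) :
  continuous (fun x : R => ker C (cos x) * q.[cos x] * sin x).
Proof.
move=> x; apply: cvgM; last exact: continuous_sin.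
by apply: cvgM; [exact: continuous_ker_cos|exact: continuous_horner_cos].
Qed.

Lemma kerintD p q : kerint (p + q) = kerint p + kerint q.
Proof.
rewrite /kerint -intpiD; [|exact: continuous_kerint..].
by apply: eq_intpi => x _; rewrite hornerD mulrDr mulrDl.
Qed.

Lemma kerintZ c p : kerint (c *: p) = c * kerint p.
Proof.
rewrite /kerint -intpiZ; last exact: continuous_kerint.
by apply: eq_intpi => x _; rewrite hornerZ; ring.
Qed.

Lemma kerintN p : kerint (- p) = - kerint p.
Proof. by rewrite -scaleN1r kerintZ mulN1r. Qed.

(** The integrand on the left is the derivative of [sqrt (2 (C - cos x)) * g (cos x)]; in the term
    with [g'] the root is rewritten as [ker] times [2 (C - cos x)]. *)
Lemma kerint_ibp (g : {poly R}) :
  kerint g - kerint (((2 * C)%:P - 2%:P * 'X) * g^`())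
  = Num.sqrt (2 * (C + 1)) * g.[-1] - Num.sqrt (2 * (C - 1)) * g.[1].
Proof.
rewrite /kerint -intpiB; [|exact: continuous_kerint..].
pose F (x : R) := Num.sqrt (2 * (C - cos x)) * g.[cos x].
pose f (x : R) := ker C (cos x) * g.[cos x] * sin x
  - ker C (cos x) * (((2 * C)%:P - 2%:P * 'X) * g^`()).[cos x] * sin x.
have pos (x : R) : 0 < 2 * (C - cos x) by rewrite mulr_gt0 // subr_gt0 (le_lt_trans (cos_le1 _)).
have dF (x : R) : is_derive x 1 F (f x).
  have H1 : is_derive x 1 (fun x : R => C - cos x) (sin x).
    have H : is_derive x 1 (cst C - cos) (0 - - sin x) by exact: is_deriveB.
    by apply: (is_derive_eq H); rewrite sub0r opprK.
  have H2 : is_derive x 1 (fun x : R => 2 * (C - cos x)) (2 * sin x).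
    exact: (is_derive_eq (is_deriveZ 2 H1)).
  have H3 : is_derive x 1 (Num.sqrt \o (fun x : R => 2 * (C - cos x)))
      ((2 * Num.sqrt (2 * (C - cos x)))^-1 * (2 * sin x)).
    by apply: is_derive1_comp; exact: is_derive1_sqrt.
  have H4 : is_derive x 1 (horner g \o cos) (g^`().[cos x] * - sin x).
    exact: is_derive1_comp.
  apply: (is_derive_eq (is_deriveM H3 H4)).
  rewrite /f /ker /GRing.scale /= !(hornerM, hornerD, hornerN, hornerC, hornerX).
  have s0 : Num.sqrt (2 * (C - cos x)) != 0 by rewrite gt_eqF // sqrtr_gt0.
  have s2 : Num.sqrt (2 * (C - cos x)) ^+ 2 = 2 * (C - cos x) by rewrite sqr_sqrtr // ltW.
  have -> : 2 * C - 2 * cos x = Num.sqrt (2 * (C - cos x)) ^+ 2 by rewrite s2; ring.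
  by move: (Num.sqrt _) s0 => s s0; field.
rewrite (intpi_deriv _ dF) /F ?cospi ?cos0 ?opprK //.
by move=> x; apply: cvgB; exact: continuous_kerint.
Qed.

(** Apply [kerint_ibp] to [P_(n+2) - P_n]: it vanishes at both endpoints, and its derivative is a
    multiple of [P_(n+1)]. The product [X P_(n+1)] is then expanded by the three-term recurrence. *)
Lemma kerint_legendreP_recurrence n :
  (2 * n.+2%:R + 1) * kerint (P n.+2)
  = 2 * C * ((2 * n.+1%:R + 1) * kerint (P n.+1)) - (2 * n%:R + 1) * kerint (P n).
Proof.
have := kerint_ibp (P n.+2 - P n).
have V (e : R) : e ^+ 2 = 1 -> (P n.+2 - P n).[e] = 0.
  move=> He; rewrite hornerD hornerN !legendreP_at_sign // !exprS mulrA -expr2 He.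
  by rewrite mul1r subrr.
rewrite (V (-1)) ?sqrrN ?expr1n // (V 1) ?expr1n // !mulr0 subrr.
rewrite derivB legendreP_deriv_recurrence.
have -> : ((2 * C)%:P - 2%:P * 'X) * ((2 * n.+1%:R + 1) *: P n.+1)
    = (2 * C * (2 * n.+1%:R + 1)) *: P n.+1 - 2 *: ((2 * n.+1%:R + 1) *: ('X * P n.+1)).
  by move: (P n.+1) => p; rewrite -!mul_polyC; ring.
have -> : (2 * n.+1%:R + 1) *: ('X * P n.+1) = n.+2%:R *: P n.+2 + n.+1%:R *: P n.
  by rewrite legendreP_recurrence subrK.
move: (P n.+2) (P n.+1) (P n) => p2 p1 p0.
rewrite !(kerintD, kerintN, kerintZ) => H.
ring_from H.
Qed.

End RingKernel.

(** * Closed form of these integrals in the parameter [rho], where [2 C = rho + 1 / rho] *)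

Section RingKernelRho.
Variable R : realType.
Local Notation P := (@legendreP R).
Variables (rho : R).
Hypothesis rho01 : 0 < rho < 1.
Let C := (rho + rho^-1) / 2.

(** The recurrence has characteristic roots [rho] and [1 / rho]. The values at [n = 0] and [n = 1],
    found from [sqrt (2 (C + 1)) = 1 / b + b] and [sqrt (2 (C - 1)) = 1 / b - b] with
    [b = sqrt rho], select the powers of [rho]. *)
Lemma kerint_legendreP n :
  (2 * n%:R + 1) * kerint C (P n) = 2 * rho ^+ n * Num.sqrt rho.
Proof.
have /andP[r0 r1] := rho01.
pose b := Num.sqrt rho.
have b0 : 0 < b by rewrite sqrtr_gt0.
have bn0 : b != 0 by rewrite gt_eqF.
have b2 : rho = b ^+ 2 by rewrite sqr_sqrtr // ltW.
have b1 : b < 1 by rewrite -[ltRHS]sqrtr1 ltr_sqrt.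
have C1 : 1 < C.
  have -> : C = 1 + (1 - rho) ^+ 2 / (2 * rho) by rewrite /C; field; rewrite gt_eqF.
  by rewrite ltrDl; apply: divr_gt0; rewrite ?exprn_gt0 ?subr_gt0 // mulr_gt0.
have E1 : Num.sqrt (2 * (C + 1)) = b^-1 + b.
  have -> : 2 * (C + 1) = (b^-1 + b) ^+ 2 by rewrite /C b2; field.
  by rewrite sqrtr_sqr ger0_norm // addr_ge0 ?invr_ge0 ?(ltW b0).
have E2 : Num.sqrt (2 * (C - 1)) = b^-1 - b.
  have -> : 2 * (C - 1) = (b^-1 - b) ^+ 2 by rewrite /C b2; field.
  rewrite sqrtr_sqr ger0_norm // subr_ge0 (le_trans (ltW b1)) // ltW //.
  by rewrite invf_gt1.
have S0 : kerint C 1 = 2 * b.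
  have := kerint_ibp C1 1; rewrite -polyC1 derivC mulr0 !hornerC E1 E2.
  have -> : kerint C 0 = 0 by rewrite -(scale0r (0 : {poly R})) kerintZ // mul0r.
  by rewrite subr0 => ->; ring.
have S1 : 3 * kerint C 'X = 2 * rho * b.
  have := kerint_ibp C1 'X; rewrite derivX mulr1 !hornerX E1 E2.
  rewrite (_ : (2 * C)%:P - 2%:P * 'X = (2 * C) *: 1 + (- 2) *: 'X); last first.
    by rewrite -!mul_polyC; ring.
  rewrite kerintD // !kerintZ // S0 => H.
  transitivity (2 * C * (2 * b) - 2 * b^-1); last by rewrite /C b2; field.
  ring_from H.
suff : (2 * n%:R + 1) * kerint C (P n) = 2 * rho ^+ n * b /\
       (2 * n.+1%:R + 1) * kerint C (P n.+1) = 2 * rho ^+ n.+1 * b by case.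
elim: n => [|n [IH1 IH2]].
  rewrite legendreP0 legendreP1 S0 expr0 expr1 -S1; split; ring.
split=> //; rewrite kerint_legendreP_recurrence // IH1 IH2 /C !exprS.
by field; rewrite gt_eqF.
Qed.

End RingKernelRho.

(** * The Funk-Hecke formula for the kernel itself, with [C > 1] *)

Section RingKernelLimit.
Variable R : realType.
Local Notation P := (@legendreP R).
Variables (C : R) (C1 : 1 < C) (th' : R).

Definition ringker m (th : R) : R :=
  intpi (fun psi => ker C (sphcos th th' psi) * cos (m%:R * psi)).

Let err J : R := J.+1%:R * C^-1 ^+ J / (1 - C^-1).

Lemma ringker_unif m J th : `|azim (kerpoly C J) m th th' - ringker m th| <= err J * pi.
Proof.
have ck : continuous (fun psi : R => ker C (sphcos th th' psi) * cos (m%:R * psi)).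
  move=> x; apply: cvgM; last exact: continuous_cos_natmul.
  apply: continuous_ker; last exact: continuous_sphcos.
  by move=> y; rewrite (le_lt_trans (ler_norm _)) // (le_lt_trans (normr_sphcos_le1 _ _ _)).
rewrite /azim /ringker -intpiB //; last exact: continuous_azim_integrand.
apply: norm_intpi_le => [x|x _].
  by apply: cvgB; [exact: continuous_azim_integrand|exact: ck].
rewrite -mulrBl normrM -[leRHS]mulr1; apply: ler_pM => //.
  by apply: kerpoly_unif => //; exact: normr_sphcos_le1.
exact: normr_cos_le1.
Qed.

Lemma cvg_err_mul0 c : (err J * c) @[J --> \oo] --> (0 : R).
Proof.
rewrite -[X in _ --> X](mul0r c); apply: cvgM; last exact: cvg_cst.
exact: kerpoly_err_cvg0.
Qed.

Lemma continuous_sin_exp m : continuous (fun x : R => sin x ^+ m).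
Proof.
move=> x; apply: (@continuous_comp _ _ _ sin (fun x : R => x ^+ m)).
  exact: continuous_sin.
exact: exprn_continuous.
Qed.

Lemma continuous_azim q m : continuous (fun th : R => azim q m th th').
Proof.
have [Q [HQ _]] := azim_funk_hecke q th' (leqnn m).
rewrite (_ : (fun th => _) = fun th => sin th ^+ m * Q.[cos th]); last exact/funext.
by move=> x; apply: cvgM; [exact: continuous_sin_exp|exact: continuous_horner_cos].
Qed.

Lemma continuous_ringker m : continuous (ringker m).
Proof.
apply: (continuous_uniform_limit (fun J => @continuous_azim (kerpoly C J) m) (cvg_err_mul0 pi)).
by move=> J x; exact: ringker_unif.
Qed.

Lemma horner_cos_bounded (p : {poly R}) : exists2 B, 0 <= B & forall x, `|p.[cos x]| <= B.
Proof.
exists (\sum_(i < size p) `|p`_i|); first exact: sumr_ge0.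
move=> x; rewrite horner_coef (le_trans (ler_norm_sum _ _ _)) //; apply: ler_sum => i _.
by rewrite normrM ler_piMr // normrX exprn_ile1 // normr_cos_le1.
Qed.

Lemma normr_sin_exp_le1 m (x : R) : `|sin x ^+ m| <= 1.
Proof. by rewrite normrX exprn_ile1 // ler_norml sin_geN1 sin_le1. Qed.

(** For each [kerpoly C J] this is [azim_funk_hecke]. Both sides converge by the uniform error
    bound, and limits are unique. *)
Lemma ringker_funk_hecke m n : (m <= n)%N ->
  intpi (fun th => ringker m th * sin th ^+ m * ((P n)^`(m)).[cos th] * sin th)
  = pi * sin th' ^+ m * ((P n)^`(m)).[cos th'] * kerint C (P n).
Proof.
move=> mn; set p := (P n)^`(m).
have [B B0 pB] := horner_cos_bounded p.
have [B' B0' pB'] := horner_cos_bounded (P n).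
pose w (th : R) := sin th ^+ m * p.[cos th] * sin th.
have cw : continuous w.
  move=> x; apply: cvgM; last exact: continuous_sin.
  by apply: cvgM; [exact: continuous_sin_exp|exact: continuous_horner_cos].
have wB x : `|w x| <= B.
  rewrite /w !normrM -[leRHS]mulr1; apply: ler_pM => //.
    by rewrite -[leRHS]mul1r; apply: ler_pM => //; exact: normr_sin_exp_le1.
  by have := normr_sin_exp_le1 1 x; rewrite expr1.
pose F J (th : R) := azim (kerpoly C J) m th th' * w th.
have cF J : continuous (F J).
  by move=> x; apply: cvgM; [exact: continuous_azim|exact: cw].
have L1 : intpi (F J) @[J --> \oo] --> intpi (fun th => ringker m th * w th).
  apply: (cvg_intpi_uniform_limit cF (cvg_err_mul0 (pi * B))) => J x.
  rewrite /F -mulrBl normrM mulrA; apply: ler_pM => //; exact: ringker_unif.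
have L2 : Lam (kerpoly C J * P n) @[J --> \oo] --> kerint C (P n).
  apply: (cvg_intpi_uniform_limit _ (cvg_err_mul0 B')) => [J|J x].
    exact: continuous_horner_cos_sin.
  rewrite hornerM -mulrBl -mulrBl normrM normrM -[leRHS]mulr1; apply: ler_pM => //.
    by apply: ler_pM => //; apply: kerpoly_unif => //; exact: normr_cos_le1.
  by have := normr_sin_exp_le1 1 x; rewrite expr1.
have E J : intpi (F J) = pi * sin th' ^+ m * p.[cos th'] * Lam (kerpoly C J * P n).
  have [Q [HQ LQ]] := azim_funk_hecke (kerpoly C J) th' mn.
  rewrite -LQ; apply: eq_intpi => x _; rewrite /F HQ -sin_wt_horner /w -/p; ring.
rewrite (@eq_intpi _ _ (fun th => ringker m th * w th)) => [|x _]; last by rewrite /w; ring.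
apply: (@cvg_unique _ (@Rhausdorff R) _ _ _ _ L1).
rewrite (_ : (fun J => _) = fun J => pi * sin th' ^+ m * p.[cos th'] * Lam (kerpoly C J * P n)).
  by apply: cvgM; [exact: cvg_cst|exact: L2].
exact/funext.
Qed.

End RingKernelLimit.

(** * Values of the Gamma function at positive integers and half-integers *)

Section GammaHalfIntegers.
Variable R : realType.

Definition gamma_fun (s x : R) : R := x `^ (s - 1) * expR (- x).

(** A certificate for [Gamma s = l]. Carrying a primitive along lets the functional equation be
    proved by differentiation and limits. *)
Definition gamma_primitive (s l : R) (F : R -> R) :=
  [/\ forall x : R, 0 < x -> is_derive x 1 F (gamma_fun s x),
      F x @[x --> 0^'+] --> (0 : R) & F x @[x --> +oo] --> l].

Lemma is_derive_expRN (x : R) : is_derive x 1 (fun x : R => expR (- x)) (- expR (- x)).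
Proof.
have H : is_derive x 1 (expR \o -%R) (expR (- x) * - 1) by exact: is_derive1_comp.
by apply: (is_derive_eq H); rewrite mulrN1.
Qed.

Lemma continuous_expRN : continuous (fun x : R => expR (- x)).
Proof.
move=> x; apply: differentiable_continuous; apply/derivable1_diffP.
by have [] := is_derive_expRN x.
Qed.

Lemma is_derive_powR_expRN (a x : R) : 0 < x ->
  is_derive x 1 (fun x : R => x `^ a * expR (- x))
    (a * (x `^ (a - 1) * expR (- x)) - x `^ a * expR (- x)).
Proof.
move=> x0; apply: (is_derive_eq (is_deriveM (is_derive1_powR a x0) (is_derive_expRN x))).
by rewrite /GRing.scale /=; ring.
Qed.

Lemma continuous_gamma_fun s (x : R) : 0 < x -> {for x, continuous (gamma_fun s)}.
Proof.
move=> x0; apply: differentiable_continuous; apply/derivable1_diffP.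
by have [] := is_derive_powR_expRN (s - 1) x0.
Qed.

Lemma gamma_fun_ge0 s x : 0 <= gamma_fun s x.
Proof. by rewrite /gamma_fun mulr_ge0 ?powR_ge0 ?expR_ge0. Qed.

(** The integrand may be singular at [0], so the fundamental theorem is used on [[1 / (i + 1),
    +oo[]; these sets increase to []0, +oo[] and the integrand is nonnegative. *)
Lemma Gamma_primitive s l F : gamma_primitive s l F -> Gamma s = l.
Proof.
move=> [dF F0 Fl].
have cF (x : R) : 0 < x -> F y @[y --> x] --> F x.
  move=> x0; apply: differentiable_continuous; apply/derivable1_diffP.
  by have [] := dF _ x0.
pose D i := `[(i.+1%:R^-1 : R), +oo[%classic.
have i0 i : 0 < (i.+1%:R^-1 : R) by rewrite invr_gt0.
have DU : \bigcup_i D i = `]0%R, +oo[%classic.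
  apply/seteqP; split=> x /=.
    by move=> [i _]; rewrite /D /= !in_itv /= !andbT; exact: lt_le_trans.
  rewrite in_itv /= andbT => x0.
  exists (Num.bound x^-1) => //; rewrite /D /= in_itv /= andbT.
  rewrite -[leRHS]invrK lef_pV2 ?posrE ?invr_gt0 //.
  rewrite (le_trans (ltW (archi_boundP _))) ?invr_ge0 ?(ltW x0) //.
  by rewrite ler_nat.
have wc i : {within D i, continuous (gamma_fun s)}.
  apply/continuous_within_itvcyP; split.
    move=> x; rewrite in_itv /= andbT => ix; apply: continuous_gamma_fun.
    exact: lt_trans (i0 i) ix.
  by apply: cvg_at_right_filter; exact: continuous_gamma_fun.
have I i : (\int[lebesgue_measure]_(x in D i) (gamma_fun s x)%:E = (l - F i.+1%:R^-1)%:E)%E.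
  rewrite (@ge0_continuous_FTC2y _ (gamma_fun s) F i.+1%:R^-1 l) //.
  - by move=> x _; exact: gamma_fun_ge0.
  - exact: wc.
  - by move=> x ix; have [] := dF _ (lt_trans (i0 i) ix).
  - by apply: cvg_at_right_filter; exact: cF.
  - move=> x; rewrite in_itv /= andbT => ix; rewrite derive1E.
    by have [_] := dF _ (lt_trans (i0 i) ix).
rewrite /Gamma /Rintegral -DU.
have nD : nondecreasing_seq D.
  apply/nondecreasing_seqP => i; rewrite subsetEset /D => x /=.
  rewrite !in_itv /= !andbT; apply: le_trans.
  by rewrite lef_pV2 ?posrE // ler_nat.
have mD i : measurable (D i) by exact: measurable_itv.
have mf i : measurable_fun (D i) (gamma_fun s).
  apply: subspace_continuous_measurable_fun => //; exact: wc.
have : (\int[lebesgue_measure]_(x in D i) (gamma_fun s x)%:E @[i --> \oo]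
    --> \int[lebesgue_measure]_(x in \bigcup_i D i) (gamma_fun s x)%:E)%E.
  apply: ge0_nondecreasing_set_cvg_integral => //.
    by move=> i; apply/measurable_EFinP; exact: mf.
  by move=> i x _; rewrite lee_fin gamma_fun_ge0.
rewrite (_ : (fun i => _) = fun i => (l - F i.+1%:R^-1)%:E); last first.
  by apply/funext => i; rewrite -I.
have L : (l - F i.+1%:R^-1)%:E @[i --> \oo] --> l%:E.
  apply: cvg_EFin; first exact: nearW.
  rewrite -[X in _ --> X]subr0; apply: cvgB; first exact: cvg_cst.
  move/cvg_at_rightP : F0 => /(_ (fun i => i.+1%:R^-1)); apply; split=> //.
  exact: cvg_harmonic.
by move/(cvg_unique (@ereal_hausdorff R) L) => /(congr1 fine) /= ->.
Qed.

Lemma cvg_powR_expRN_pinfty (s : R) : 0 < s -> x `^ s * expR (- x) @[x --> +oo] --> (0 : R).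
Proof.
move=> s0; pose N := Num.bound s.
apply: (@squeeze_cvgr _ _ _ _ (cst 0) (fun x => N.+1`!%:R * x^-1)); last 2 first.
- exact: cvg_cst.
- rewrite -[X in _ --> X](mulr0 (N.+1`!%:R : R)); apply: cvgM; first exact: cvg_cst.
  apply: (iffRL (gtr0_cvgV0 (f := idfun) _)); last exact: cvg_id.
  by apply: nbhs_pinfty_gt; rewrite num_real.
near=> x.
have x1 : 1 <= x by near: x; apply: nbhs_pinfty_ge; rewrite num_real.
have x0 : 0 < x by rewrite (lt_le_trans _ x1).
apply/andP; split; first by rewrite mulr_ge0 ?powR_ge0 ?expR_ge0.
have F0 : 0 < N.+1`!%:R :> R by rewrite ltr0n fact_gt0.
rewrite expRN ler_pdivrMr ?expR_gt0 //.
have H : x ^+ N.+1 <= N.+1`!%:R * expR x.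
  rewrite mulrC -ler_pdivrMr // (le_trans _ (expR_ge1Dxn N (ltW x0))) //.
  by rewrite lerDr.
rewrite mulrAC ler_pdivlMr // (le_trans _ H) // exprSr ler_pM2r //.
rewrite -powR_mulrn ?(ltW x0) // ler_powR //.
by rewrite ltW // archi_boundP // ltW.
Unshelve. all: by end_near. Qed.

(** Integration by parts, at the level of primitives, for [Gamma (s + 1) = s Gamma s]. *)
Lemma gamma_primitiveS s l F : 0 < s -> gamma_primitive s l F ->
  gamma_primitive (s + 1) (s * l) (fun x => s * F x - x `^ s * expR (- x)).
Proof.
move=> s0 [dF F0 Fl]; split.
- move=> x x0.
  apply: (is_derive_eq (is_deriveB (is_deriveZ s (dF _ x0)) (is_derive_powR_expRN s x0))).
  by rewrite /gamma_fun addrK /GRing.scale /=; ring.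
- rewrite -[X in _ --> X]subr0 -[X in X - _](mulr0 s); apply: cvgB.
    by apply: cvgM; [exact: cvg_cst|].
  rewrite -[X in _ --> X](mul0r (expR (- 0))); apply: cvgM; first exact: powR_cvg0.
  by apply: cvg_at_right_filter; exact: continuous_expRN.
- rewrite -[X in _ --> X]subr0; apply: cvgB; first by apply: cvgM; [exact: cvg_cst|].
  exact: cvg_powR_expRN_pinfty.
Qed.

Lemma gamma_primitive1 : gamma_primitive 1 1 (fun x => 1 - expR (- x)).
Proof.
split.
- move=> x x0.
  have H : is_derive x 1 (cst (1 : R) - (fun x => expR (- x))) (0 - - expR (- x)).
    by apply: is_deriveB; exact: is_derive_expRN.
  by apply: (is_derive_eq H); rewrite sub0r opprK /gamma_fun subrr powRr0 mul1r.
- rewrite -[X in _ --> X](subrr (1 : R)); apply: cvgB; first exact: cvg_cst.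
  rewrite -[X in _ --> X]expR0 -[X in expR X]oppr0.
  by apply: cvg_at_right_filter; exact: continuous_expRN.
- by rewrite -[X in _ --> X]subr0; apply: cvgB; [exact: cvg_cst|exact: cvgr_expR].
Qed.

(** The substitution [t = u^2] turns [Gamma (1/2)] into twice the Gaussian integral over the
    half-line. *)
Lemma gamma_primitive_half : gamma_primitive 2^-1 (Num.sqrt pi)
  (fun x => 2 * gauss_integral_proof.integral0_gauss (Num.sqrt x)).
Proof.
pose G := @gauss_integral_proof.integral0_gauss R.
have iG (u : R) : lebesgue_measure.-integrable `[0%R, u] (EFin \o (@gauss_fun R)).
  apply: continuous_compact_integrable; first exact: segment_compact.
  by apply: continuous_subspaceT; exact: continuous_gauss_fun.
have dG (y : R) : 0 < y -> is_derive y 1 G (gauss_fun y).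
  move=> y0.
  have [||d E] := @continuous_FTC1_closed R (@gauss_fun R) 0 y (y + 1) _ (iG _) y0.
  - by rewrite ltrDl.
  - exact: continuous_gauss_fun.
  by apply: DeriveDef; [exact: d|rewrite -derive1E; exact: E].
have Gle (y : R) : 0 <= y -> G y <= y.
  move=> y0; rewrite /G /gauss_integral_proof.integral0_gauss.
  have := @le_Rintegral _ _ R lebesgue_measure `[0%R, y]%classic (@gauss_fun R) (cst 1).
  move=> /(_ _ (iG y)); rewrite Rintegral_cst // => H.
  apply: (le_trans (H _ _ _)) => //.
  - apply: continuous_compact_integrable; first exact: segment_compact.
    by apply: continuous_subspaceT => x; exact: cvg_cst.
  - by move=> x _; exact: gauss_fun_le1.
  - have -> : fine (lebesgue_measure (`[0%R, y]%classic : set R)) = y.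
      by rewrite lebesgue_measure_itv /= lte_fin; case: ltP => [|y0'] /=; lra.
    by rewrite mul1r.
have sqrty : Num.sqrt (x : R) @[x --> +oo] --> +oo.
  apply/cvgryPge => A; near=> x.
  have Ax : A ^+ 2 <= x by near: x; apply: nbhs_pinfty_ge; rewrite num_real.
  rewrite (le_trans (ler_norm A)) // -sqrtr_sqr; exact: ler_wsqrtr.
split.
- move=> x x0.
  have s0 : 0 < Num.sqrt x by rewrite sqrtr_gt0.
  have H : is_derive x 1 (G \o Num.sqrt) (gauss_fun (Num.sqrt x) * (2 * Num.sqrt x)^-1).
    by apply: is_derive1_comp; [exact: dG|exact: is_derive1_sqrt].
  apply: (is_derive_eq (is_deriveZ 2 H)).
  rewrite /gamma_fun /gauss_fun sqr_sqrtr ?(ltW x0) // /GRing.scale /=.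
  rewrite (_ : 2^-1 - 1 = - 2^-1); last by field.
  rewrite powRN powR12_sqrt ?(ltW x0) //.
  by move: (expR _) => e; field; rewrite gt_eqF.
- rewrite -[X in _ --> X](mulr0 2); apply: cvgM; first exact: cvg_cst.
  apply: (@squeeze_cvgr _ _ _ _ (cst 0) Num.sqrt); last 2 first.
  + exact: cvg_cst.
  + rewrite -[X in _ --> X]sqrtr0; apply: cvg_at_right_filter; exact: sqrt_continuous.
  near=> x; rewrite gauss_integral_proof.integral0_gauss_ge0 /=.
  by apply: Gle; exact: sqrtr_ge0.
- have -> : Num.sqrt pi = 2 * (Num.sqrt pi / 2) :> R by field.
  apply: cvgM; first exact: cvg_cst.
  apply: (cvg_comp _ _ sqrty).
  have : Num.sqrt (G x ^+ 2) @[x --> +oo] --> Num.sqrt (pi / 4).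
    apply: continuous_cvg; first exact: sqrt_continuous.
    exact: gauss_integral_proof.cvg_integral0_gauss_sqr.
  have -> : Num.sqrt (pi / 4) = Num.sqrt pi / 2 :> R.
    rewrite sqrtrM ?pi_ge0 // sqrtrV // (_ : 4 = 2 ^+ 2); last by ring.
    by rewrite sqrtr_sqr ger0_norm.
  rewrite (_ : (fun x => Num.sqrt _) = G) //.
  by apply/funext => x; rewrite sqrtr_sqr ger0_norm // gauss_integral_proof.integral0_gauss_ge0.
Unshelve. all: by end_near. Qed.

Lemma gamma_primitive_nat s l F m : 0 < s -> gamma_primitive s l F ->
  exists F', gamma_primitive (s + m%:R) (poch s m * l) F'.
Proof.
move=> s0 H; elim: m => [|m [F' IH]].
  by exists F; rewrite addr0 poch0 mul1r.
have sm : 0 < s + m%:R by rewrite ltr_wpDr.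
exists (fun x => (s + m%:R) * F' x - x `^ (s + m%:R) * expR (- x)).
have := gamma_primitiveS sm IH; rewrite -addrA natr1 pochS.
by rewrite mulrA [_ * poch _ _]mulrC.
Qed.

(** The argument is spelled as [nu + 1] in [LegendreQ] at [nu = m - 1/2]; likewise [nu + 3/2] in
    [Gamma_nat]. *)
Lemma Gamma_half m : Gamma (m%:R - 2^-1 + 1) = poch 2^-1 m * Num.sqrt pi :> R.
Proof.
have [|F H] := gamma_primitive_nat m _ gamma_primitive_half; first by rewrite invr_gt0.
by rewrite -(Gamma_primitive H); congr Gamma; field.
Qed.

Lemma poch1 m : poch 1 m = m`!%:R :> R.
Proof.
elim: m => [|m IH]; first by rewrite poch0.
by rewrite pochS IH factS natrM mulrC nat1r.
Qed.

Lemma Gamma_nat m : Gamma (m%:R - 2^-1 + 3 / 2) = m`!%:R :> R.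
Proof.
have [|F H] := gamma_primitive_nat m _ gamma_primitive1 => //.
by rewrite -poch1 -[RHS]mulr1 -(Gamma_primitive H); congr Gamma; field.
Qed.

End GammaHalfIntegers.

(** * Heine's formula for [Q_(m-1/2)], its monotonicity and continuity *)

Section HeineFormula.
Variable R : realType.

(** Two consecutive factors of the left side, halved, are one factor of each shifted factorial on
    the right; this brings in the parameters of the hypergeometric series. *)
Lemma poch_half_duplication m k :
  poch 2^-1 (m + k.*2) = 4 ^+ k * poch 2^-1 m
    * poch ((m%:R - 2^-1 + 2) / 2) k * poch ((m%:R - 2^-1 + 1) / 2) k :> R.
Proof.
elim: k => [|k IH]; first by rewrite addn0 !poch0 expr0; ring.
rewrite doubleS !addnS !pochS IH exprS -addSn natrD -mul2n natrM.
by field.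
Qed.

Lemma poch_succ m k : poch (m%:R - 2^-1 + 3 / 2) k * m`!%:R = (m + k)`!%:R :> R.
Proof.
elim: k => [|k IH]; first by rewrite poch0 addn0 mul1r.
rewrite pochS addnS factS natrM -IH.
by field.
Qed.

Lemma heine_term m k : bincoef R (m + k.*2) * cosmom R m (m + k.*2)
  = pi * poch 2^-1 m / (m`!%:R * 2 ^+ m)
    * (poch ((m%:R - 2^-1 + 2) / 2) k * poch ((m%:R - 2^-1 + 1) / 2) k
        / (poch (m%:R - 2^-1 + 3 / 2) k * k`!%:R)).
Proof.
rewrite cosmomE /bincoef poch_half_duplication.
have F j : (j`!%:R : R) != 0 by rewrite pnatr_eq0 -lt0n fact_gt0.
have E2 : 'C(m + k.*2, k)%:R = (m + k.*2)`!%:R / (k`!%:R * (m + k)`!%:R) :> R.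
  have H : (k <= m + k.*2)%N by lia.
  apply: (mulIf (mulf_neq0 (F k) (F (m + k)%N))); rewrite divfK ?mulf_neq0 //.
  rewrite -!natrM -(bin_fact H) (_ : (m + k.*2 - k)%N = (m + k)%N) //; lia.
have E3 : poch (m%:R - 2^-1 + 3 / 2) k = (m + k)`!%:R / m`!%:R :> R.
  by rewrite -poch_succ mulfK.
rewrite E2 E3 exprD.
have -> : (2 ^+ k.*2 : R) = 4 ^+ k by rewrite -mul2n exprM; congr (_ ^+ k); ring.
have T : (2 ^+ m : R) != 0 by rewrite expf_neq0 // pnatr_eq0.
have T4 : (4 ^+ k : R) != 0 by rewrite expf_neq0 // pnatr_eq0.
by field; rewrite !F T T4.
Qed.

(** By [heine_term] the series of Heine's integral is the constant [A] times the hypergeometric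
    series, and [A] matches the prefactor of [LegendreQ]. *)
Lemma LegendreQ_heine m (z : R) : 1 < z -> LegendreQ (m%:R - 2^-1) z = heine m z.
Proof.
move=> z1; have z0 : 0 < z by rewrite (lt_trans _ z1).
rewrite /LegendreQ /hyp2F1reg Gamma_half Gamma_nat /hyp2F1.
set u := fun k : nat => _.
have F j : (j`!%:R : R) != 0 by rewrite pnatr_eq0 -lt0n fact_gt0.
have Tm : (2 ^+ m : R) != 0 by rewrite expf_neq0 // pnatr_eq0.
have zm : z ^+ m != 0 by rewrite expf_neq0 // gt_eqF.
have s0 : Num.sqrt (2 * z) != 0 by rewrite gt_eqF // sqrtr_gt0 mulr_gt0.
pose A : R := (Num.sqrt (2 * z))^-1 * (pi * poch 2^-1 m / (m`!%:R * 2 ^+ m)) / z ^+ m.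
have A0 : A != 0.
  rewrite /A !mulf_neq0 ?invr_neq0 ?mulf_neq0 //.
    by rewrite gt_eqF // pi_gt0.
  by rewrite gt_eqF // poch_gt0 // invr_gt0.
have E K : (Num.sqrt (2 * z))^-1 * (\sum_(k < K)
    bincoef R (m + k.*2) * z^-1 ^+ (m + k.*2) * cosmom R m (m + k.*2)) = A * series u K.
  rewrite /series /= big_mkord !mulr_sumr; apply: eq_bigr => k _.
  rewrite mulrAC heine_term /A /u exprD.
  have -> : z^-1 ^+ k.*2 = (z ^- 2) ^+ k by rewrite -mul2n exprM !exprVn.
  rewrite [in LHS]exprVn.
  move: (z ^- 2 ^+ k) (_ / (poch (m%:R - 2^-1 + 3 / 2) k * k`!%:R)) => a b.
  ring.
have := @heine_series_even R m _ z1.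
rewrite (_ : (fun K => _) = fun K => A * series u K); last exact/funext.
move=> L.
have L2 : series u K @[K --> \oo] --> A^-1 * heine m z.
  rewrite (_ : (fun K => _) = fun K => A^-1 * (A * series u K)); last first.
    by apply/funext => K; rewrite mulKf.
  by apply: cvgM; [exact: cvg_cst|exact: L].
have -> : limn (series u) = A^-1 * heine m z by exact: (cvg_lim _ L2).
have P2 (x : R) : 0 < x -> x `^ (m%:R - 2^-1 + 1) = x ^+ m * Num.sqrt x.
  move=> x0; rewrite (_ : m%:R - 2^-1 + 1 = m%:R + 2^-1); last by field.
  rewrite powRD; last by apply/implyP => _; rewrite gt_eqF.
  by rewrite powR_mulrn ?(ltW x0) // powR12_sqrt // ltW.
rewrite !P2 // /A sqrtrM //.
have p0 : (pi : R) = Num.sqrt pi ^+ 2 by rewrite sqr_sqrtr // pi_ge0.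
rewrite [in X in _ * X]p0.
have sp0 : Num.sqrt (pi : R) != 0 by rewrite gt_eqF // sqrtr_gt0 pi_gt0.
have s20 : Num.sqrt (2 : R) != 0 by rewrite gt_eqF // sqrtr_gt0.
have sz0 : Num.sqrt z != 0 by rewrite gt_eqF // sqrtr_gt0.
have h0 : poch 2^-1 m != 0 :> R by rewrite gt_eqF // poch_gt0 // invr_gt0.
move: (Num.sqrt pi) (Num.sqrt 2) (Num.sqrt z) (poch _ _) sp0 s20 sz0 h0 => a b c d a0 b0 c0 d0.
by field; rewrite a0 b0 c0 d0 F Tm zm.
Qed.

Lemma cosmom_ge0 m k : 0 <= cosmom R m (m + k.*2).
Proof. by rewrite cosmomE divr_ge0 ?exprn_ge0 // mulr_ge0 // pi_ge0. Qed.

(** The series in powers of [1 / z] has nonnegative coefficients, and so does its prefactor decrease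
    in [z]; the inequality holds for all partial sums. *)
Lemma le_heine m (z1 z2 : R) : 1 < z1 -> z1 <= z2 -> heine m z2 <= heine m z1.
Proof.
move=> h1 h12; have h2 := lt_le_trans h1 h12.
have z10 : 0 < z1 by rewrite (lt_trans _ h1).
have z20 : 0 < z2 by rewrite (lt_trans _ h2).
apply: (ler_cvg_to (@heine_series_even R m _ h2) (@heine_series_even R m _ h1)).
apply: nearW => K; apply: ler_pM.
- by rewrite invr_ge0 sqrtr_ge0.
- apply: sumr_ge0 => k _; rewrite mulr_ge0 ?cosmom_ge0 // mulr_ge0 ?bincoef_ge0 //.
  by rewrite exprn_ge0 // invr_ge0 ltW.
- rewrite lef_pV2 ?posrE ?sqrtr_gt0 ?mulr_gt0 //.
  by apply: ler_wsqrtr; rewrite ler_pM2l.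
- apply: ler_sum => k _; rewrite ler_wpM2r ?cosmom_ge0 // ler_wpM2l ?bincoef_ge0 //.
  by rewrite lerXn2r ?nnegrE ?invr_ge0 ?(ltW z10) ?(ltW z20) // lef_pV2.
Qed.

Lemma heine_ge0 m (z : R) : 1 < z -> 0 <= heine m z.
Proof.
move=> z1; have z0 : 0 < z by rewrite (lt_trans _ z1).
apply: (ler_cvg_to (cvg_cst (0 : R)) (@heine_series_even R m _ z1)).
apply: nearW => K; rewrite mulr_ge0 ?invr_ge0 ?sqrtr_ge0 //.
apply: sumr_ge0 => k _; rewrite mulr_ge0 ?cosmom_ge0 // mulr_ge0 ?bincoef_ge0 //.
by rewrite exprn_ge0 // invr_ge0 ltW.
Qed.

(** Subadditivity of the square root gives [b - a <= c] for the three roots below, and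
    [a b >= a^2 >= 2 (z0 - 1)]. *)
Lemma ker_dist (z0 z t : R) : 1 < z0 -> z0 <= z -> t <= 1 ->
  `|ker z t - ker z0 t| <= Num.sqrt (2 * (z - z0)) / (2 * (z0 - 1)).
Proof.
move=> z01 z0z t1; rewrite /ker.
have a0 : 0 < 2 * (z0 - t) by rewrite mulr_gt0 // subr_gt0 (le_lt_trans t1).
have b0 : 0 < 2 * (z - t) by rewrite (lt_le_trans a0) // ler_pM2l // lerD2r.
pose a := Num.sqrt (2 * (z0 - t)); pose b := Num.sqrt (2 * (z - t)).
pose c := Num.sqrt (2 * (z - z0)).
have a'0 : 0 < a by rewrite sqrtr_gt0.
have b'0 : 0 < b by rewrite sqrtr_gt0.
have c'0 : 0 <= c by rewrite sqrtr_ge0.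
have a2 : a ^+ 2 = 2 * (z0 - t) by rewrite sqr_sqrtr // ltW.
have b2 : b ^+ 2 = 2 * (z - t) by rewrite sqr_sqrtr // ltW.
have c2 : c ^+ 2 = 2 * (z - z0) by rewrite sqr_sqrtr // mulr_ge0 // subr_ge0.
have ab : a <= b by apply: ler_wsqrtr; rewrite ler_pM2l // lerD2r.
have bac : b <= a + c.
  rewrite -(ler_pXn2r (ltn0Sn 1)) ?nnegrE ?addr_ge0 ?(ltW a'0) ?(ltW b'0) //.
  have -> : b ^+ 2 = a ^+ 2 + c ^+ 2 by rewrite a2 b2 c2; ring.
  have := mulr_ge0 (ltW a'0) c'0; rewrite sqrrD; lra.
rewrite -/a -/b -/c distrC ger0_norm; last by rewrite subr_ge0 lef_pV2.
have -> : a^-1 - b^-1 = (b - a) / (a * b) by field; rewrite !gt_eqF.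
apply: ler_pM.
- by rewrite subr_ge0.
- by rewrite invr_ge0 mulr_ge0 // ltW.
- by rewrite lerBlDl.
- rewrite lef_pV2 ?posrE ?mulr_gt0 ?subr_gt0 //.
  apply: (@le_trans _ _ (a ^+ 2)); last by rewrite expr2 ler_pM2l.
  by rewrite a2 ler_pM2l // lerD2l lerN2.
Qed.

Lemma cvg_heine m (z0 : R) (z_ : nat -> R) : 1 < z0 -> (forall i, z0 <= z_ i) ->
  z_ i @[i --> \oo] --> z0 -> heine m (z_ i) @[i --> \oo] --> heine m z0.
Proof.
move=> z01 z0z zz0.
have z1 i : 1 < z_ i by rewrite (lt_le_trans z01).
have cf i : continuous (fun x : R => ker (z_ i) (cos x) * cos (m%:R * x)).
  move=> x; apply: cvgM; last exact: continuous_cos_natmul.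
  exact: continuous_ker_cos.
have e0 : Num.sqrt (2 * (z_ i - z0)) / (2 * (z0 - 1)) @[i --> \oo] --> (0 : R).
  rewrite -[X in _ --> X](mul0r (2 * (z0 - 1))^-1); apply: cvgM; last exact: cvg_cst.
  rewrite -[X in _ --> X]sqrtr0; apply: continuous_cvg; first exact: sqrt_continuous.
  rewrite -[X in _ --> X](mulr0 2); apply: cvgM; first exact: cvg_cst.
  by rewrite -(subrr z0); apply: cvgB; [|exact: cvg_cst].
apply: (cvg_intpi_uniform_limit cf e0) => i x.
rewrite -mulrBl normrM -[leRHS]mulr1; apply: ler_pM => //; last exact: normr_cos_le1.
by apply: ker_dist => //; exact: cos_le1.
Qed.

(** Factoring [sin th sin th'] out of [C - sphcos th th' psi] leaves the toroidal argument minus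
    [cos psi]. *)
Lemma heine_ringker (C th th' : R) m : 1 < C -> 0 < sin th -> 0 < sin th' ->
  heine m ((C - cos th * cos th') / (sin th * sin th'))
  = Num.sqrt (sin th * sin th') * ringker C th' m th.
Proof.
move=> C1 s0 s'0; have ss : 0 < sin th * sin th' by rewrite mulr_gt0.
have ck : continuous (fun psi : R => ker C (sphcos th th' psi) * cos (m%:R * psi)).
  move=> x; apply: cvgM; last exact: continuous_cos_natmul.
  apply: continuous_ker; last exact: continuous_sphcos.
  by move=> y; rewrite (le_lt_trans (ler_norm _)) // (le_lt_trans (normr_sphcos_le1 _ _ _)).
rewrite /heine /ringker -intpiZ //; apply: eq_intpi => psi _.
rewrite mulrA; congr (_ * _); rewrite /ker /sphcos.
have pos : 0 < 2 * ((C - cos th * cos th') / (sin th * sin th') - cos psi).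
  have -> : 2 * ((C - cos th * cos th') / (sin th * sin th') - cos psi)
      = 2 * (C - sphcos th th' psi) / (sin th * sin th').
    by rewrite /sphcos; field; rewrite !gt_eqF.
  rewrite divr_gt0 // mulr_gt0 // subr_gt0 (le_lt_trans (ler_norm _)) //.
  by rewrite (le_lt_trans (normr_sphcos_le1 _ _ _)).
have -> : 2 * (C - (cos th * cos th' + sin th * sin th' * cos psi))
    = sin th * sin th' * (2 * ((C - cos th * cos th') / (sin th * sin th') - cos psi)).
  by field; rewrite !gt_eqF.
rewrite (sqrtrM _ (ltW ss)).
move: pos ss; rewrite -sqrtr_gt0 => X0; rewrite -sqrtr_gt0 => S0.
move: (Num.sqrt (2 * _)) (Num.sqrt (sin th * sin th')) X0 S0 => X S X0 S0.
by field; rewrite !gt_eqF.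
Qed.

End HeineFormula.

(** * The argument [chi], and the integral for [C > 1] *)

Section ToroidalIntegral.
Variable R : realType.
Local Notation P := (@legendreP R).

Lemma coshB (a b : R) : cosh (a - b) = cosh a * cosh b - sinh a * sinh b.
Proof. by rewrite /cosh /sinh opprB expRD [expR (b - a)]expRD; field. Qed.

Lemma sinh2E (a : R) : sinh a ^+ 2 = cosh a ^+ 2 - 1.
Proof.
have := expRxMexpNx_1 a; rewrite /sinh /cosh; move: (expR a) (expR (- a)) => x y H.
by apply: (eq_of_subr (esym H)); field.
Qed.

Lemma cosh_gt1 (a : R) : 0 < a -> 1 < cosh a.
Proof.
move=> a0; have e1 : 1 < expR a by rewrite expR_gt1.
have := expRxMexpNx_1 a; rewrite /cosh expRN; move: (expR a) e1 => x x1 _.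
have x0 : 0 < x by rewrite (lt_trans _ x1).
have -> : (x + x^-1) / 2 = 1 + (x - 1) ^+ 2 / (2 * x) by field; rewrite gt_eqF.
by rewrite ltrDl; apply: divr_gt0; rewrite ?exprn_gt0 ?subr_gt0 // mulr_gt0.
Qed.

(** As [sin^2 + sinh^2 = cosh^2 - cos^2], the numerator is divisible by [cosh s - cos th] and by
    [cosh s' - cos th']; the quotient contains [cosh (s - s')] in expanded form. *)
Lemma chiE (s s' th th' : R) : 0 < s -> 0 < s' ->
  chi s s' th th' = (cosh (s - s') - cos th * cos th') / (sin th * sin th').
Proof.
move=> s0 s'0; rewrite /chi /= coshB.
(* Where a sine vanishes, both sides are divisions by zero and take the default value [0]. *)
have [S0|S0] := eqVneq (sin th) 0; first by rewrite S0 !(mulr0, mul0r) invr0 !mulr0.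
have [S'0|S'0] := eqVneq (sin th') 0; first by rewrite S'0 !(mulr0, mul0r) invr0 !mulr0.
have d0 : cosh s - cos th != 0.
  by rewrite gt_eqF // subr_gt0 (le_lt_trans (cos_le1 _)) // cosh_gt1.
have d'0 : cosh s' - cos th' != 0.
  by rewrite gt_eqF // subr_gt0 (le_lt_trans (cos_le1 _)) // cosh_gt1.
have -> : sin th ^+ 2 * (cosh s' - cos th') ^+ 2 + sin th' ^+ 2 * (cosh s - cos th) ^+ 2
   + ((cosh s' - cos th') * sinh s - (cosh s - cos th) * sinh s') ^+ 2
   = 2 * (cosh s - cos th) * (cosh s' - cos th')
     * (cosh s * cosh s' - sinh s * sinh s' - cos th * cos th').
  apply: (@eq_of_subr _
    ((cosh s' - cos th') ^+ 2 * (sin th ^+ 2 + sinh s ^+ 2)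
      + (cosh s - cos th) ^+ 2 * (sin th' ^+ 2 + sinh s' ^+ 2))
    ((cosh s' - cos th') ^+ 2 * (1 - cos th ^+ 2 + (cosh s ^+ 2 - 1))
      + (cosh s - cos th) ^+ 2 * (1 - cos th' ^+ 2 + (cosh s' ^+ 2 - 1)))).
    by rewrite !sin2cos2 !sinh2E.
  ring.
by field; rewrite S0 S'0 d0 d'0.
Qed.

Variables (m : nat) (th' : R).
Hypothesis th'0pi : 0 < th' < pi.

Let s'0 : 0 < sin th'. Proof. exact: sin_gt0_pi. Qed.

Definition torarg (C th : R) : R := (C - cos th * cos th') / (sin th * sin th').

Definition torint n (C th : R) : R :=
  LegendreQ (m%:R - 2^-1) (torarg C th) * Ferrers m n (cos th) * Num.sqrt (sin th).

(** The right-hand side, [rho] standing for [exp (- |sigma - sigma'|)]. *)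
Definition torval n (rho : R) : R :=
  2 * pi * Num.sqrt (sin th') / (2 * n%:R + 1) * Ferrers m n (cos th')
    * (rho ^+ n * Num.sqrt rho).

Lemma Ferrers_cos n (th : R) : 0 <= sin th ->
  Ferrers m n (cos th) = (-1) ^+ m * sin th ^+ m * ((P n)^`(m)).[cos th].
Proof.
by move=> s0; rewrite /Ferrers -sin2cos2 sqrtr_sqr ger0_norm.
Qed.

Lemma torarg_gt1 (C th : R) : 0 < sin th -> cos (th - th') < C -> 1 < torarg C th.
Proof.
move=> s0 cC; have ss : 0 < sin th * sin th' by rewrite mulr_gt0.
by rewrite /torarg ltr_pdivlMr // mul1r ltrBrDl -cosB.
Qed.

(** The integrand without its sign and the polynomial [P_n^(m)], written through [ringker] so that
    it is continuous also where [sin th = 0]. *)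
Definition torbase (C th : R) : R :=
  Num.sqrt (sin th') * ringker C th' m th * sin th ^+ m * sin th.

Lemma torbase_heine (C th : R) : 1 < C -> 0 < sin th ->
  torbase C th = heine m (torarg C th) * sin th ^+ m * Num.sqrt (sin th).
Proof.
move=> C1 s0; rewrite /torarg heine_ringker // sqrtrM ?(ltW s0) // /torbase.
by rewrite -[X in _ * X = _](sqr_sqrtr (ltW s0)); ring.
Qed.

Lemma torbase_Q (C th : R) : 1 < C -> 0 <= sin th ->
  torbase C th
  = LegendreQ (m%:R - 2^-1) (torarg C th) * sin th ^+ m * Num.sqrt (sin th).
Proof.
move=> C1; rewrite le_eqVlt => /predU1P[E|s0]; first by rewrite /torbase -E sqrtr0 !mulr0.
rewrite torbase_heine // LegendreQ_heine // torarg_gt1 //.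
by rewrite (le_lt_trans (cos_le1 _)).
Qed.

Lemma continuous_torbase (C : R) : 1 < C -> continuous (torbase C).
Proof.
move=> C1 x; apply: cvgM; last exact: continuous_sin.
apply: cvgM; last exact: continuous_sin_exp.
by apply: cvgM; [exact: cvg_cst|exact: continuous_ringker].
Qed.

Lemma sin_ge0_0pi (x : R) : 0 <= x <= pi -> 0 <= sin x.
Proof. by move=> H; apply: sin_ge0_pi. Qed.

Lemma torintE n (C th : R) : 1 < C -> 0 <= th <= pi ->
  torint n C th = (-1) ^+ m * torbase C th * ((P n)^`(m)).[cos th].
Proof.
move=> C1 /sin_ge0_0pi s0; rewrite /torint torbase_Q // Ferrers_cos //; ring.
Qed.

Lemma continuous_torintE n (C : R) : 1 < C ->
  continuous (fun th => (-1) ^+ m * torbase C th * ((P n)^`(m)).[cos th]).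
Proof.
move=> C1 x; apply: cvgM; last exact: continuous_horner_cos.
by apply: cvgM; [exact: cvg_cst|exact: continuous_torbase].
Qed.

Lemma half_sum_inv_gt1 (rho : R) : 0 < rho < 1 -> 1 < (rho + rho^-1) / 2.
Proof.
move=> /andP[r0 r1].
have -> : (rho + rho^-1) / 2 = 1 + (1 - rho) ^+ 2 / (2 * rho) by field; rewrite gt_eqF.
by rewrite ltrDl; apply: divr_gt0; rewrite ?exprn_gt0 ?subr_gt0 // mulr_gt0.
Qed.

Lemma intpi_torbase n rho : (m <= n)%N -> 0 < rho < 1 ->
  intpi (fun th => (-1) ^+ m * torbase ((rho + rho^-1) / 2) th * ((P n)^`(m)).[cos th])
  = torval n rho.
Proof.
move=> mn r01; have C1 := half_sum_inv_gt1 r01.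
set C := (rho + rho^-1) / 2 in C1 *; set p := (P n)^`(m).
pose c := (-1) ^+ m * Num.sqrt (sin th').
have cr : continuous (fun th => ringker C th' m th * sin th ^+ m * p.[cos th] * sin th).
  move=> x; apply: cvgM; last exact: continuous_sin.
  apply: cvgM; last exact: continuous_horner_cos.
  by apply: cvgM; [exact: continuous_ringker|exact: continuous_sin_exp].
rewrite (@eq_intpi _ _ (fun th =>
  c * (ringker C th' m th * sin th ^+ m * p.[cos th] * sin th))); last first.
  by move=> x _; rewrite /torbase /c; ring.
rewrite intpiZ // ringker_funk_hecke // /torval Ferrers_cos ?(ltW s'0) //.
have n0 : (2 * n%:R + 1 : R) != 0 by rewrite gt_eqF // ltr_wpDl // mulr_ge0.
have := kerint_legendreP r01 n; rewrite -/C => H.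
have -> : kerint C (P n) = 2 * rho ^+ n * Num.sqrt rho / (2 * n%:R + 1).
  by rewrite -H mulrC mulKf.
by rewrite /c -/p; field.
Qed.

Lemma torint_gt1 n rho : (m <= n)%N -> 0 < rho < 1 ->
  lebesgue_measure.-integrable `[0%R, pi] (EFin \o torint n ((rho + rho^-1) / 2)) /\
  intpi (torint n ((rho + rho^-1) / 2)) = torval n rho.
Proof.
move=> mn r01; have C1 := half_sum_inv_gt1 r01.
split; last by rewrite -intpi_torbase //; apply: eq_intpi => x /(torintE n C1).
have := integrable_continuous (continuous_torintE (n := n) C1); apply: eq_integrable => //.
by move=> x; rewrite inE /= in_itv /= => /(torintE n C1) ->.
Qed.

Lemma derivn_legendreP_diag : (P m)^`(m) = (((P m)^`(m)).[1])%:P.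
Proof.
have S : (size ((P m)^`(m)) <= 1)%N.
  rewrite derivn_legendreP (leq_trans (size_scale_leq _ _)) //.
  apply/leq_sizeP => i i1; rewrite coef_derivn nth_default ?mul0rn //.
  have s3 : (size (sqX1 R) <= 3)%N.
    rewrite /sqX1 (leq_trans (size_polyD _ _)) // size_polyN size_polyXn size_poly1.
    by [].
  have k2 : ((size (sqX1 R)).-1 * m <= 2 * m)%N by rewrite leq_mul2r; lia.
  apply: (leq_trans (size_poly_exp_leq (sqX1 R) m)); apply: (leq_ltn_trans k2); lia.
by rewrite [in LHS](size1_polyC S) [in RHS](size1_polyC S) hornerC.
Qed.

(** For [n = m] the polynomial [P_m^(m)] is constant, which isolates the integral of [torbase]; its
    limit will bound the monotone sequence. *)
Lemma intpi_torbase_diag rho : 0 < rho < 1 ->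
  intpi (torbase ((rho + rho^-1) / 2))
  = (-1) ^+ m / ((P m)^`(m)).[1] * torval m rho.
Proof.
move=> r01; have C1 := half_sum_inv_gt1 r01.
have p0 := derivn_legendreP_at1_neq0 R (leqnn m).
rewrite -(intpi_torbase (leqnn m) r01) derivn_legendreP_diag.
rewrite -intpiZ; last by rewrite -derivn_legendreP_diag; exact: continuous_torintE.
apply: eq_intpi => x _; rewrite !hornerC.
have : (-1) ^+ m * (-1) ^+ m = 1 :> R by rewrite -exprD addnn -signr_odd odd_double.
move: ((-1) ^+ m) p0 (torbase _ _) => e p0 t e2.
by transitivity (e * e * t); [rewrite e2 mul1r|field].
Qed.

(** * The singular case [C = 1] as a limit along [C_ i > 1] *)

Let rho_ i : R := i.+1%:R / i.+2%:R.
Let C_ i : R := (rho_ i + (rho_ i)^-1) / 2.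

Let rho_01 i : 0 < rho_ i < 1.
Proof. by rewrite /rho_ divr_gt0 //= ltr_pdivrMr // mul1r ltr_nat. Qed.

Let C_gt1 i : 1 < C_ i. Proof. exact: half_sum_inv_gt1. Qed.

Let C_E i : C_ i = 1 + (2 * i.+1%:R * i.+2%:R)^-1.
Proof.
have i1 : (i.+1%:R : R) != 0 by rewrite pnatr_eq0.
have i2 : (i.+2%:R : R) != 0 by rewrite pnatr_eq0.
rewrite /C_ /rho_; move: i1 i2; rewrite -[i.+2%:R]natr1; move: (i.+1%:R : R) => x x0 x1.
by field; rewrite x0 x1.
Qed.

Let C_noninc i j : (i <= j)%N -> C_ j <= C_ i.
Proof.
move=> ij; rewrite !C_E lerD2l lef_pV2 ?posrE ?mulr_gt0 //.
by apply: ler_pM => //; rewrite ?mulr_ge0 // ?ler_pM2l // ler_nat.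
Qed.

Let C_cvg : C_ i @[i --> \oo] --> (1 : R).
Proof.
apply/subr_cvg0; apply: (@squeeze_cvgr _ _ _ _ (cst 0) (fun i => i.+1%:R^-1)); last 2 first.
- exact: cvg_cst.
- exact: cvg_harmonic.
apply: nearW => i; rewrite C_E addrC addKr invr_ge0 /= mulr_ge0 ?mulr_ge0 //=.
rewrite lef_pV2 ?posrE ?mulr_gt0 // -mulrA mulrCA -[leLHS]mulr1 ler_pM2l //.
by rewrite -natrM ler1n muln_gt0.
Qed.

Let rho_cvg : rho_ i @[i --> \oo] --> (1 : R).
Proof.
rewrite (_ : rho_ = fun i => 1 - i.+2%:R^-1).
  rewrite -[X in _ --> X]subr0; apply: cvgB; first exact: cvg_cst.
  apply: (@cvg_comp _ _ _ succn (fun i : nat => i.+1%:R^-1 : R)); last exact: cvg_harmonic.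
  by move=> A [N _ NA]; exists N => // i /= Ni; apply: NA => /=; lia.
apply/funext => i; rewrite /rho_ -[i.+2%:R]natr1.
have : (i.+1%:R + 1 : R) != 0 by rewrite natr1 pnatr_eq0.
by move: (i.+1%:R : R) => x x0; field.
Qed.

Let torval_cvg n : torval n (rho_ i) @[i --> \oo] --> torval n 1.
Proof.
apply: cvgM; first exact: cvg_cst.
apply: cvgM.
  by apply: (cvg_comp rho_ (fun x : R => x ^+ n) rho_cvg); exact: exprn_continuous.
by apply: (cvg_comp rho_ Num.sqrt rho_cvg); exact: sqrt_continuous.
Qed.

(** Through [torarg_gt1] this makes [th'] the only point of the interval, apart from the zeros of
    the sine, where [torarg 1] may fail to exceed [1]. *)
Lemma cosB_lt1 (th : R) : 0 <= th <= pi -> th != th' -> cos (th - th') < 1.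
Proof.
move=> /andP[t0 tpi] tt'; have /andP[t'0 t'pi] := th'0pi.
have d : `|th - th'| <= pi by rewrite ler_norml; apply/andP; split; lra.
rewrite -cos_norm -[ltRHS]cos0 ltr_cos ?in_itv /= ?lexx ?pi_ge0 ?normr_ge0 ?d //.
by rewrite normr_gt0 subr_eq0.
Qed.

Let torlim (th : R) : R :=
  LegendreQ (m%:R - 2^-1) (torarg 1 th) * sin th ^+ m * Num.sqrt (sin th).

Let le_torarg (C C' th : R) : 0 < sin th -> C <= C' -> torarg C th <= torarg C' th.
Proof.
move=> s0 CC'; rewrite /torarg ler_pM2r ?lerD2r //.
by rewrite invr_gt0 mulr_gt0.
Qed.

Let torarg_C_gt1 i (th : R) : 0 < sin th -> 1 < torarg (C_ i) th.
Proof. by move=> s0; apply: torarg_gt1 => //; rewrite (le_lt_trans (cos_le1 _)). Qed.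

Let torbase_ge0 i (th : R) : 0 <= th <= pi -> 0 <= torbase (C_ i) th.
Proof.
move=> /sin_ge0_0pi; rewrite le_eqVlt => /predU1P[E|s0].
  by rewrite /torbase -E !mulr0.
rewrite torbase_heine // mulr_ge0 ?sqrtr_ge0 // mulr_ge0 ?exprn_ge0 ?(ltW s0) //.
by rewrite heine_ge0 // torarg_C_gt1.
Qed.

Let torbase_nondec (th : R) : 0 <= th <= pi ->
  forall i j, (i <= j)%N -> torbase (C_ i) th <= torbase (C_ j) th.
Proof.
move=> /sin_ge0_0pi; rewrite le_eqVlt => /predU1P[E|s0] i j ij.
  by rewrite /torbase -E !mulr0.
rewrite !torbase_heine // ler_wpM2r ?sqrtr_ge0 // ler_wpM2r ?exprn_ge0 ?(ltW s0) //.
by apply: le_heine; [exact: torarg_C_gt1|apply: le_torarg => //; exact: C_noninc].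
Qed.

Let torbase_cvg (th : R) : 0 <= th <= pi -> th != th' ->
  torbase (C_ i) th @[i --> \oo] --> torlim th.
Proof.
move=> t0pi tt'; have := sin_ge0_0pi t0pi; rewrite le_eqVlt => /predU1P[E|s0].
  rewrite (_ : (fun i => _) = fun=> torlim th); first exact: cvg_cst.
  by apply/funext => i; rewrite /torbase /torlim -E sqrtr0 !mulr0.
have z1 : 1 < torarg 1 th by apply: torarg_gt1 => //; exact: cosB_lt1.
rewrite (_ : (fun i => _) = fun i => heine m (torarg (C_ i) th) * sin th ^+ m * Num.sqrt (sin th)).
  rewrite /torlim LegendreQ_heine //.
  apply: cvgM; last exact: cvg_cst.
  apply: cvgM; last exact: cvg_cst.
  apply: cvg_heine => // [i|]; first by apply: le_torarg => //; exact: ltW.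
  apply: cvgM; last exact: cvg_cst.
  by apply: cvgB; [exact: C_cvg|exact: cvg_cst].
by apply/funext => i; rewrite torbase_heine.
Qed.

Let torbase_le_lim i (th : R) : 0 <= th <= pi -> th != th' -> torbase (C_ i) th <= torlim th.
Proof.
move=> t0pi tt'; apply: (ler_cvg_to (cvg_cst (torbase (C_ i) th)) (torbase_cvg t0pi tt')).
by exists i => // j /= ij; exact: torbase_nondec.
Qed.

Let D : set R := `[0%R, pi]%classic `\ th'.

Let mD : measurable D. Proof. exact: measurableD. Qed.

Let DP x : D x -> 0 <= x <= pi /\ x != th'.
Proof. by move=> [/=]; rewrite in_itv /= => xI /eqP xt. Qed.

Let integral_D (f : R -> R) : continuous f ->
  (\int[lebesgue_measure]_(x in D) (f x)%:E = (intpi f)%:E)%E.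
Proof.
move=> cf; rewrite integral_setD1 //; last first.
  by apply/measurable_EFinP; apply: measurable_funTS; exact: continuous_measurable_fun.
rewrite /Rintegral fineK //; apply: integrable_fin_num => //.
exact: integrable_continuous.
Qed.

Let mtorlim : measurable_fun D (EFin \o torlim).
Proof.
apply: (emeasurable_fun_cvg (fun i => EFin \o torbase (C_ i))).
  move=> i; apply/measurable_EFinP; apply: measurable_funTS.
  by apply: continuous_measurable_fun; exact: continuous_torbase.
by move=> x /DP[x0 xt]; apply: cvg_EFin; [exact: nearW|exact: torbase_cvg].
Qed.

Let torlim_ge0 x : D x -> 0 <= torlim x.
Proof. by move=> /DP[x0 xt]; rewrite (le_trans (torbase_ge0 0 x0)) // torbase_le_lim. Qed.

(** The functions [torbase (C_ i)] increase to [torlim], and their integrals converge by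
    [intpi_torbase_diag]; monotone convergence makes the integral of [torlim] finite. *)
Let integrable_torlim : lebesgue_measure.-integrable D (EFin \o torlim).
Proof.
apply/integrableP; split; first exact: mtorlim.
have M : (\int[lebesgue_measure]_(x in D) (torbase (C_ i) x)%:E @[i --> \oo]
    --> \int[lebesgue_measure]_(x in D) limn (fun i => (torbase (C_ i) x)%:E))%E.
  apply: cvg_monotone_convergence => //.
  - move=> i; apply/measurable_EFinP; apply: measurable_funTS.
    by apply: continuous_measurable_fun; exact: continuous_torbase.
  - by move=> i x /DP[x0 _]; rewrite lee_fin torbase_ge0.
  - by move=> x /DP[x0 _] i j ij; rewrite lee_fin torbase_nondec.
have L : (\int[lebesgue_measure]_(x in D) (torbase (C_ i) x)%:E @[i --> \oo]
    --> ((-1) ^+ m / ((P m)^`(m)).[1] * torval m 1)%:E)%E.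
  rewrite (_ : (fun i => _) = fun i => ((-1) ^+ m / ((P m)^`(m)).[1] * torval m (rho_ i))%:E).
    apply: cvg_EFin; first exact: nearW.
    by apply: cvgM; [exact: cvg_cst|exact: torval_cvg].
  by apply/funext => i; rewrite integral_D ?intpi_torbase_diag //; exact: continuous_torbase.
have E : (\int[lebesgue_measure]_(x in D) `|(EFin \o torlim) x|
    = ((-1) ^+ m / ((P m)^`(m)).[1] * torval m 1)%:E)%E.
  rewrite -(cvg_unique (@ereal_hausdorff R) M L); apply: eq_integral => x.
  rewrite inE => Dx; have [x0 xt] := DP Dx.
  rewrite gee0_abs ?lee_fin ?torlim_ge0 //; apply/esym/cvg_lim => //.
  by apply: cvg_EFin; [exact: nearW|exact: torbase_cvg].
by rewrite E ltry.
Qed.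

(** Dominated convergence along [C_ i], with a bound of [P_n^(m)] times [torlim] as the dominating
    function. *)
Lemma torint_eq1 n : (m <= n)%N ->
  lebesgue_measure.-integrable `[0%R, pi] (EFin \o torint n 1) /\
  intpi (torint n 1) = torval n 1.
Proof.
move=> mn; set p := (P n)^`(m).
have [B B0 pB] := horner_cos_bounded p.
pose w i (th : R) : R := (-1) ^+ m * torbase (C_ i) th * p.[cos th].
have cw i : continuous (w i) by exact: continuous_torintE.
have tE x : D x -> torint n 1 x = (-1) ^+ m * torlim x * p.[cos x].
  by move=> /DP[/sin_ge0_0pi x0 _]; rewrite /torint /torlim Ferrers_cos // -/p; ring.
have mw i : measurable_fun D (EFin \o w i).
  by apply/measurable_EFinP; apply: measurable_funTS; exact: continuous_measurable_fun.
have wcvg x : D x -> (EFin \o w i) x @[i --> \oo] --> (torint n 1 x)%:E.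
  move=> Dx; have [x0 xt] := DP Dx; rewrite tE //.
  apply: cvg_EFin; first exact: nearW.
  apply: cvgM; last exact: cvg_cst.
  by apply: cvgM; [exact: cvg_cst|exact: torbase_cvg].
have mt : measurable_fun D (EFin \o torint n 1).
  exact: (emeasurable_fun_cvg (fun i => EFin \o w i)).
have ig : lebesgue_measure.-integrable D (EFin \o (fun x => B * torlim x)).
  rewrite (_ : _ \o _ = (fun x => B%:E * (torlim x)%:E)%E); last first.
    by apply/funext => x; rewrite /= EFinM.
  exact: integrableZl.
have wg x : D x -> forall i, (`|(w i x)%:E| <= (B * torlim x)%:E)%E.
  move=> Dx i; have [x0 xt] := DP Dx; rewrite lee_fin /w 2!normrM normrX normrN1 expr1n mul1r mulrC.
  apply: ler_pM => //.
  by rewrite ger0_norm ?torbase_ge0 //; exact: torbase_le_lim.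
have [||It _ Lt] := @dominated_convergence _ _ R lebesgue_measure D mD (fun i => EFin \o w i)
  (EFin \o torint n 1) (EFin \o (fun x => B * torlim x)) mw mt _ ig _.
- by apply: aeW; exact: wcvg.
- by apply: aeW => x i Dx; exact: wg.
have E : (\int[lebesgue_measure]_(x in `[0%R, pi]) (torint n 1 x)%:E = (torval n 1)%:E)%E.
  (* The point [th'] has measure zero, so the integral may be taken over [D]. *)
  rewrite -(integral_setD1 (r := th')) //.
  apply: (cvg_unique (@ereal_hausdorff R) Lt).
  rewrite (_ : (fun i => _) = fun i => (torval n (rho_ i))%:E).
    by apply: cvg_EFin; [exact: nearW|exact: torval_cvg].
  by apply/funext => i; rewrite /= integral_D // intpi_torbase.
split; last by rewrite /Rintegral E.
(* Measurability on the whole interval is regained by adding the singleton back. *)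
have mt' : measurable_fun `[0%R, pi] (EFin \o torint n 1).
  rewrite -(@setD1K _ th' `[0%R, pi]%classic); last first.
    by have /andP[/ltW a /ltW b] := th'0pi; rewrite /= in_itv /= a.
  by apply/measurable_funU => //; split => //; exact: measurable_fun_set1.
move/integrableP : It => [_ It]; apply/integrableP; split => //.
rewrite -(integral_setD1 (r := th')) //.
by apply: measurableT_comp.
Qed.

End ToroidalIntegral.

(** * The integral in the variables [sigma] and [sigma'], split at [sigma = sigma'] *)

Theorem theorem3p5 (R : realType) (m n : nat) (sigma sigma' theta' : R) :
  (m <= n)%N -> 0 < sigma -> 0 < sigma' -> 0 < theta' < pi ->
  (lebesgue_measure).-integrable `[0%R, pi]
     (fun theta : R => (LegendreQ (m%:R - 2^-1) (chi sigma sigma' theta theta')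
        * Ferrers m n (cos theta) * Num.sqrt (sin theta))%:E) /\
  Rintegral lebesgue_measure `[0%R, pi]
     (fun theta : R => LegendreQ (m%:R - 2^-1) (chi sigma sigma' theta theta')
        * Ferrers m n (cos theta) * Num.sqrt (sin theta))
  = 2 * pi * Num.sqrt (sin theta') / (2 * n%:R + 1) * Ferrers m n (cos theta')
    * expR (- (n%:R + 2^-1) * (Num.max sigma sigma' - Num.min sigma sigma')).
Proof.
move=> mn s0 s'0 t'.
pose d := Num.max sigma sigma' - Num.min sigma sigma'.
pose rho := expR (- d).
have rho0 : 0 < rho by exact: expR_gt0.
(* Here [d] is [|sigma - sigma'|], and [cosh] is even. *)
have Ch : cosh (sigma - sigma') = (rho + rho^-1) / 2.
  rewrite /rho /d -expRN opprK /cosh maxEle minEle; case: ifP => _.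
    by rewrite !opprB.
  by rewrite addrC.
have E th : LegendreQ (m%:R - 2^-1) (chi sigma sigma' th theta') * Ferrers m n (cos th)
    * Num.sqrt (sin th) = torint m theta' n ((rho + rho^-1) / 2) th.
  by rewrite /torint /torarg chiE // Ch.
have -> : 2 * pi * Num.sqrt (sin theta') / (2 * n%:R + 1) * Ferrers m n (cos theta')
    * expR (- (n%:R + 2^-1) * d) = torval m theta' n rho.
  rewrite /torval; congr (_ * _).
  rewrite -powR12_sqrt ?(ltW rho0) // /rho -expRM_natl -expRM -expRD; congr expR; ring.
have [I J] : lebesgue_measure.-integrable `[0%R, pi]
    (EFin \o torint m theta' n ((rho + rho^-1) / 2)) /\
    intpi (torint m theta' n ((rho + rho^-1) / 2)) = torval m theta' n rho.
  have : 0 <= d by rewrite /d subr_ge0 ge_min le_max lexx.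
  rewrite le_eqVlt => /predU1P[dE|d0].
    (* Equal [sigma] and [sigma'] give [rho = 1] and [C = 1], the singular case. *)
    have -> : rho = 1 by rewrite /rho -dE oppr0 expR0.
    have -> : (1 + 1^-1) / 2 = 1 :> R by field.
    exact: torint_eq1.
  by apply: torint_gt1 => //; rewrite rho0 expR_lt1 oppr_lt0.
split; last by rewrite -J; apply: eq_intpi => th _; rewrite E.
by move: I; apply: eq_integrable => // th _; rewrite E.
Qed.
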